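(* Let $\mathcal{A}$ be a finite alphabet with $\#\mathcal{A}\ge2$ and $\mathbf{p}$ an irreducible pair on $\mathcal{A}$. Then the labeled Rauzy class of $\mathbf{p}$ contains a piece-wise order reversing pair which is of one of the Types $\langle1\rangle,\langle2\rangle,\langle3\rangle,\langle4\rangle,\langle5\rangle$.
   Context: Let $n=\#\mathcal{A}$. A pair on $\mathcal{A}$ is $\mathbf{p}=(p_0,p_1)$ with $p_0,p_1:\mathcal{A}\to\{1,\dots,n\}$ bijections (row $\varepsilon$ lists $p_\varepsilon^{-1}(1),\dots,p_\varepsilon^{-1}(n)$). $\mathbf{p}$ is irreducible if $p_0^{-1}\{1,\dots,k\}\neq p_1^{-1}\{1,\dots,k\}$ for all $1\le k<n$. Rauzy move of type $\varepsilon\in\{0,1\}$: $\varepsilon\mathbf{p}=(p_0',p_1')$ with $p'_\varepsilon=p_\varepsilon$ and, for $z=p_\varepsilon^{-1}(n)$, $p'_{1-\varepsilon}(b)=p_{1-\varepsilon}(b)$ if $p_{1-\varepsilon}(b)\le p_{1-\varepsilon}(z)$, $=p_{1-\varepsilon}(b)+1$ if $p_{1-\varepsilon}(z)<p_{1-\varepsilon}(b)<n$, $=p_{1-\varepsilon}(z)+1$ if $p_{1-\varepsilon}(b)=n$. The labeled Rauzy class of $\mathbf{p}$ is the set of pairs reachable from $\mathbf{p}$ by sequences of Rauzy moves. $\mathbf{p}$ is standard if $p_0^{-1}(1)=p_1^{-1}(n)$ and $p_1^{-1}(1)=p_0^{-1}(n)$. A standard pair is piece-wise order reversing if there are $2=k_0<k_1<\dots<k_\ell=n$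 such that for each $i$, the set $B_i=p_0^{-1}\{k_{i-1},\dots,k_i-1\}$ equals $p_1^{-1}\{k_{i-1},\dots,k_i-1\}$ and $p_0(b)+p_1(b)=k_{i-1}+k_i-1$ for $b\in B_i$. The sets $B_i$ are the (order reversing) blocks; a block with $k$ letters is a $k$-block. Chains: list the $1$-blocks from left to right as $S_1,\dots,S_{k-1}$; the chain $C_i$ ($1\le i\le k$) is the (possibly empty) sequence of consecutive blocks lying strictly between $S_{i-1}$ and $S_i$ (with $C_1$ the blocks before $S_1$ and $C_k$ the blocks after $S_{k-1}$). Types of a piece-wise order reversing pair: Type $\langle1\rangle$: at most one chain is nonempty, and a nonempty chain (if any) consists of exactly one block. Types $\langle2\rangle$–$\langle5\rangle$ all additionally require that the pair has more than one block of size $\ge2$. Type $\langle2\rangle$: every nonempty chain consists only of $2$-blocks. Type $\langle3\rangle$: every nonempty chain is either (i) $m$ consecutive $2$-blocks, then one $3$-block, then $\ell$ consecutive $2$-blocks ($m,\ell\ge0$), or (ii) $m\ge1$ consecutive $2$-blocks; and at least one chain is of form (i). Type $\langle4\rangle$: exactly one chain consists of a $4$-block followed by $m\ge0$ consecutive $2$-blocks, and all other nonempty chains consist of $2$-blocks. Type $\langle5\rangle$: exactly one chain consists of a single $5$-block and every other nonempty chain consists of exactly one $2$-block. *)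

(* Defs.v *)
From mathcomp Require Import all_boot.
From Stdlib Require Import Relations.
Set Implicit Arguments. Unset Strict Implicit. Unset Printing Implicit Defensive.

(* A pair on the alphabet A: two position functions p_0, p_1 : A -> nat
   (values meant to be in {1,..,n}, n = #|A|). *)
Definition pair_on (A : finType) := ((A -> nat) * (A -> nat))%type.

Definition pos (A : finType) (p : pair_on A) (e : bool) : A -> nat :=
  if e then p.2 else p.1.

Definition is_pair (A : finType) (p : pair_on A) : Prop :=
  forall e : bool, injective (pos p e) /\
    (forall a, 1 <= pos p e a <= #|A|).

Definition irreducible (A : finType) (p : pair_on A) : Prop :=
  forall k, 1 <= k < #|A| ->
    [set a | pos p false a <= k] != [set a | pos p true a <= k].

Definition rauzy_move (A : finType) (e : bool) (p q : pair_on A) : Prop :=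
  let n := #|A| in
  exists z : A, pos p e z = n /\
    (forall a, pos q e a = pos p e a) /\
    (forall b, pos q (~~ e) b =
       (let x := pos p (~~ e) b in let v := pos p (~~ e) z in
        if x <= v then x else if x < n then x.+1 else v.+1)).

Definition rauzy_step (A : finType) (p q : pair_on A) : Prop :=
  exists e : bool, rauzy_move e p q.

Definition in_rauzy_class (A : finType) (p q : pair_on A) : Prop :=
  clos_refl_trans (pair_on A) (@rauzy_step A) p q.

Definition standard (A : finType) (p : pair_on A) : Prop :=
  (exists a, pos p false a = 1 /\ pos p true a = #|A|) /\
  (exists b, pos p true b = 1 /\ pos p false b = #|A|).

Definition consec (ks : seq nat) : seq (nat * nat) := zip ks (behead ks).

(* ks = [:: 2 = k_0 < k_1 < ... < k_l = n] witnesses that the standard pair p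
   is piece-wise order reversing with blocks B_i = p_0^{-1}{k_{i-1},..,k_i - 1}. *)
Definition por_blocks (A : finType) (p : pair_on A) (ks : seq nat) : Prop :=
  head 0 ks = 2 /\ last 0 ks = #|A| /\ sorted ltn ks /\
  forall kk, kk \in consec ks ->
    (forall a, (kk.1 <= pos p false a < kk.2) = (kk.1 <= pos p true a < kk.2)) /\
    (forall a, kk.1 <= pos p false a < kk.2 ->
       pos p false a + pos p true a = kk.1 + kk.2 - 1).

Definition piecewise_order_reversing (A : finType) (p : pair_on A) : Prop :=
  standard p /\ exists ks, por_blocks p ks.

Definition block_sizes (ks : seq nat) : seq nat :=
  [seq kk.2 - kk.1 | kk <- consec ks].

(* Chains: split the block-size sequence at the 1-blocks.
   chains s = [:: C_1; ...; C_k], k = (number of 1-blocks) + 1. *)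
Fixpoint chains (s : seq nat) : seq (seq nat) :=
  match s with
  | [::] => [:: [::]]
  | x :: t =>
      let cs := chains t in
      if x == 1 then [::] :: cs
      else (x :: head [::] cs) :: behead cs
  end.

Definition nonempty (c : seq nat) : bool := size c != 0.
Definition all2s (c : seq nat) : bool := all (fun x => x == 2) c.

Definition many_big (s : seq nat) : bool := 1 < count (fun x => 1 < x) s.

Definition type1 (s : seq nat) : bool :=
  (count nonempty (chains s) <= 1) && all (fun c => size c <= 1) (chains s).

Definition type2 (s : seq nat) : bool :=
  many_big s && all all2s (chains s).

Definition form3i (c : seq nat) : bool :=
  (count (fun x => x == 3) c == 1) && all (fun x => (x == 2) || (x == 3)) c.
Definition form3ii (c : seq nat) : bool := nonempty c && all2s c.

Definition type3 (s : seq nat) : bool :=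
  [&& many_big s,
      all (fun c => nonempty c ==> (form3i c || form3ii c)) (chains s)
    & has form3i (chains s)].

Definition form4 (c : seq nat) : bool :=
  if c is x :: t then (x == 4) && all2s t else false.

Definition type4 (s : seq nat) : bool :=
  [&& many_big s, count form4 (chains s) == 1
    & all (fun c => nonempty c ==> (form4 c || all2s c)) (chains s)].

Definition type5 (s : seq nat) : bool :=
  [&& many_big s, count (fun c => c == [:: 5]) (chains s) == 1
    & all (fun c => nonempty c ==> ((c == [:: 5]) || (c == [:: 2]))) (chains s)].

(* Main.v *)
Require Import Defs.
From mathcomp Require Import all_boot.
From mathcomp Require Import zify.
From Stdlib Require Import Relations.
Set Implicit Arguments. Unset Strict Implicit. Unset Printing Implicit Defensive.

(** Write a standard pair as the rows [a T c] and [c S a] and keep only the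
    middle words [T] and [S].  Suitable sequences of Rauzy moves return to rows
    with the same ends [a] and [c]; on the middle words they induce the exchanges
    generating [sim] below.  An order reversing block is a factor of [T] standing
    reversed at the same place in [S], so a piece-wise order reversing pair is
    given by the list of its block sizes.

    Rauzy's lemma yields a standard pair in the class.  Its middle words become a
    concatenation of blocks: split off a last block and induct on the length.
    By induction the blocks before the last one can then be given one of the
    types.  A last block of size 1, 2 or 3 is absorbed by explicit rules on size
    lists.  If the last block is longer, then either all the others are 1-blocks
    and the pair has Type 1, or one exchange involving an earlier block of size at
    least 2 turns the end of the words into a 2-block, and the induction
    hypothesis applies to what precedes it. *)

(** * Exchanges on the middle words *)

(** Exchanges are compatible with appending arbitrary suffixes to the two words, but not with
    prepending: the two-letter exchange moves what stands before its first letter. Every rule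
    therefore carries a prefix [U], and progress is made at the right end. A 1-block is a letter at
    the same place in both words; exchanges with it can put the prefix back, so the rules that hold
    at the beginning of the words are available after a 1-block too. Exchanges at two 1-blocks
    permute the chains, except that the last chain stays last. This makes chains the natural units.
    A 4-block commutes with 2-blocks; two 4-blocks, or a 4-block followed by 2-blocks and a 3-block
    at the start of a chain, dissolve into smaller blocks; of two 3-blocks in one chain, one can be
    removed at the cost of a new 1-block. What resists is one 3-block per chain, a single 4-block,
    or a 5-block, since [[5, 1, 2]] merely becomes [[2, 1, 5]]. These residues are Types 3, 4 and
    5. *)

Section Words.
Variable T : Type.
Implicit Types (t b p r s u v w : seq T) (x y z : T).

(* [sim T S T' S']: the rows [a T c], [c S a] and [a T' c], [c S' a] lie in the same
   class for all letters [a], [c]; the three exchanges are explicit loops of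
   rotations, see [rots_swap2] and [rots_swap3]. *)
Inductive sim : seq T -> seq T -> seq T -> seq T -> Prop :=
| sim_refl t b : sim t b t b
| sim_sym t b t' b' : sim t b t' b' -> sim t' b' t b
| sim_trans t b t' b' t'' b'' :
    sim t b t' b' -> sim t' b' t'' b'' -> sim t b t'' b''
| sim_swap2 p x r y s p' r' s' :
    sim (p ++ x :: r ++ y :: s) (p' ++ x :: r' ++ y :: s')
        (r ++ y :: p ++ x :: s) (r' ++ y :: p' ++ x :: s')
| sim_swap3 p x q y r z s p' q' r' s' :
    sim (p ++ x :: q ++ y :: r ++ z :: s) (p' ++ y :: q' ++ z :: r' ++ x :: s')
        (p ++ x :: r ++ z :: q ++ y :: s) (p' ++ y :: r' ++ x :: q' ++ z :: s')
| sim_swap3' p x q y r z s p' q' r' s' :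
    sim (p' ++ y :: q' ++ z :: r' ++ x :: s') (p ++ x :: q ++ y :: r ++ z :: s)
        (p' ++ y :: r' ++ x :: q' ++ z :: s') (p ++ x :: r ++ z :: q ++ y :: s).

Lemma sim_swap2_trans t b p x r y s p' r' s' t' b' :
  t = p ++ x :: r ++ y :: s -> b = p' ++ x :: r' ++ y :: s' ->
  sim (r ++ y :: p ++ x :: s) (r' ++ y :: p' ++ x :: s') t' b' -> sim t b t' b'.
Proof. by move=> -> ->; apply: sim_trans; apply: sim_swap2. Qed.

Lemma sim_swap3_trans t b p x q y r z s p' q' r' s' t' b' :
  t = p ++ x :: q ++ y :: r ++ z :: s -> b = p' ++ y :: q' ++ z :: r' ++ x :: s' ->
  sim (p ++ x :: r ++ z :: q ++ y :: s) (p' ++ y :: r' ++ x :: q' ++ z :: s') t' b' ->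
  sim t b t' b'.
Proof. by move=> -> ->; apply: sim_trans; apply: sim_swap3. Qed.

Lemma sim_swap3'_trans t b p x q y r z s p' q' r' s' t' b' :
  t = p' ++ y :: q' ++ z :: r' ++ x :: s' -> b = p ++ x :: q ++ y :: r ++ z :: s ->
  sim (p' ++ y :: r' ++ x :: q' ++ z :: s') (p ++ x :: r ++ z :: q ++ y :: s) t' b' ->
  sim t b t' b'.
Proof. by move=> -> ->; apply: sim_trans; apply: sim_swap3'. Qed.

End Words.

Ltac split_at l x k :=
  match l with
  | x :: ?s => let T := type of x in k (@nil T) s
  | ?h :: ?s => split_at s x ltac:(fun p q => k (h :: p) q)
  | ?u ++ ?s => split_at s x ltac:(fun p q => k (u ++ p) q)
  end.
Ltac norm_words := rewrite /= ?cats0 -?catA /= ?cats0 -?catA /=.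
Ltac words_eq := by rewrite /= ?cats0 -?catA /= ?cats0 -?catA /= -?catA /=.
(* [swap2 x y] and [swap3 x y z] apply an exchange at the named letters, in the
   order in which they occur in the top word ([swap3']: in the bottom word). *)
Ltac swap2 x y :=
  norm_words; match goal with |- sim ?t ?b _ _ =>
  split_at t x ltac:(fun p t1 => split_at t1 y ltac:(fun r s =>
  split_at b x ltac:(fun p' b1 => split_at b1 y ltac:(fun r' s' =>
  apply: (@sim_swap2_trans _ _ _ p x r y s p' r' s'); [words_eq|words_eq|norm_words]))))
  end.
Ltac swap3 x y z :=
  norm_words; match goal with |- sim ?t ?b _ _ =>
  split_at t x ltac:(fun p t1 => split_at t1 y ltac:(fun q t2 => split_at t2 z ltac:(fun r s =>
  split_at b y ltac:(fun p' b1 => split_at b1 z ltac:(fun q' b2 => split_at b2 x ltac:(fun r' s' =>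
  apply: (@sim_swap3_trans _ _ _ p x q y r z s p' q' r' s'); [words_eq|words_eq|norm_words]))))))
  end.
Ltac swap3' x y z :=
  norm_words; match goal with |- sim ?t ?b _ _ =>
  split_at b x ltac:(fun p t1 => split_at t1 y ltac:(fun q t2 => split_at t2 z ltac:(fun r s =>
  split_at t y ltac:(fun p' b1 => split_at b1 z ltac:(fun q' b2 => split_at b2 x ltac:(fun r' s' =>
  apply: (@sim_swap3'_trans _ _ _ p x q y r z s p' q' r' s'); [words_eq|words_eq|norm_words]))))))
  end.

(** * Exchanges combined into rules on explicit words *)

Section Rules.
Variable T : Type.
Implicit Types (U V W Z : seq T).

(* In the names, digits are the sizes of consecutive blocks of the left-hand side and
   [k] stands for any size at least 4.  The suffixes [_nil] and [_one] cover the two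
   ways in which a chain can start: at the beginning of the words, or after a
   1-block [q]. *)
Lemma sim_2k U U' Z Z' (a b c d e f : T) :
  sim (U ++ [:: a; b; c; d] ++ Z ++ [:: e; f]) (U' ++ [:: b; a; f; e] ++ Z' ++ [:: d; c])
      (U ++ [:: a; f; c; b] ++ Z ++ [:: e; d]) (U' ++ [:: b; c; f; a] ++ Z' ++ [:: d; e]).
Proof.
swap2 a e.
swap3' f b d.
swap2 e c.
exact: sim_refl.
Qed.

Lemma sim_k2 U U' Z Z' (a b c d e f : T) :
  sim (U ++ [:: a; b] ++ Z ++ [:: c; d; e; f]) (U' ++ [:: d; c] ++ Z' ++ [:: b; a; f; e])
      (U ++ [:: a; d] ++ Z ++ [:: c; f; e; b]) (U' ++ [:: d; a] ++ Z' ++ [:: b; e; f; c]).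
Proof.
swap2 b f.
swap3' a c e.
swap2 f d.
exact: sim_refl.
Qed.

Lemma sim_4k U U' Z Z' (a b c d e f g h : T) :
  sim (U ++ [:: a; b; c; d; e; f] ++ Z ++ [:: g; h]) (U' ++ [:: d; c; b; a; h; g] ++ Z' ++ [:: f; e])
      (U ++ [:: a; d; c; b; e; h] ++ Z ++ [:: g; f]) (U' ++ [:: d; a; b; c; h; e] ++ Z' ++ [:: f; g]).
Proof.
swap2 a f.
swap3' g b e.
swap2 a c.
swap3' d g b.
swap2 f h.
exact: sim_refl.
Qed.

Lemma sim_k12 U U' Z Z' (a b c d e f g : T) :
  sim (U ++ [:: a; b] ++ Z ++ [:: c; d; e; f; g]) (U' ++ [:: d; c] ++ Z' ++ [:: b; a; e; g; f])
      (U ++ [:: a; d] ++ Z ++ [:: c; g; e; f; b]) (U' ++ [:: d; a] ++ Z' ++ [:: b; f; e; g; c]).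
Proof.
swap2 c f.
swap3 d b g.
swap2 f a.
exact: sim_refl.
Qed.

Lemma sim_k13 U U' Z Z' (a b c d e f g h : T) :
  sim (U ++ [:: a; b] ++ Z ++ [:: c; d; e; f; g; h]) (U' ++ [:: d; c] ++ Z' ++ [:: b; a; e; h; g; f])
      (U ++ [:: a; d] ++ Z ++ [:: c; b; e; h; g; f]) (U' ++ [:: d; a] ++ Z' ++ [:: b; c; e; f; g; h]).
Proof.
swap2 a f.
swap3 b e g.
swap3 a c h.
swap3 b d g.
swap2 f c.
exact: sim_refl.
Qed.

Lemma sim_53 U U' (a b c d e f g h : T) :
  sim (U ++ [:: a; b; c; d; e; f; g; h]) (U' ++ [:: e; d; c; b; a; h; g; f])
      (U ++ [:: a; e; c; f; d; h; g; b]) (U' ++ [:: e; a; c; d; f; b; g; h]).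
Proof.
swap2 d g.
swap3 f b h.
swap3' c e f.
swap2 g a.
exact: sim_refl.
Qed.

Lemma sim_35 U U' (a b c d e f g h : T) :
  sim (U ++ [:: a; b; c; d; e; f; g; h]) (U' ++ [:: c; b; a; h; g; f; e; d])
      (U ++ [:: a; d; c; f; b; h; g; e]) (U' ++ [:: c; d; a; b; f; h; e; g]).
Proof.
swap2 b g.
swap3' a c f.
swap3' h c e.
swap2 g d.
exact: sim_refl.
Qed.

Lemma sim_414 U U' (a b c d e f g h i : T) :
  sim (U ++ [:: a; b; c; d; e; f; g; h; i]) (U' ++ [:: d; c; b; a; e; i; h; g; f])
      (U ++ [:: a; d; c; b; e; f; i; h; g]) (U' ++ [:: d; a; b; c; e; i; f; g; h]).
Proof.
swap2 a g.
swap3' h b f.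
swap2 a c.
swap3' d h b.
swap2 g i.
exact: sim_refl.
Qed.

Lemma sim_2233 U U' (a b c d e f g h i j : T) :
  sim (U ++ [:: a; b; c; d; e; f; g; h; i; j]) (U' ++ [:: b; a; d; c; g; f; e; j; i; h])
      ([:: j; h; f] ++ U ++ [:: a; d; c; b; e; i; g]) ([:: h; j; f] ++ U' ++ [:: b; c; d; a; g; i; e]).
Proof.
swap2 a f.
swap3 b d g.
swap2 c h.
swap3 d g j.
swap3 c h e.
swap2 i a.
exact: sim_refl.
Qed.

(** The letter [d] becomes a 1-block, and what precedes it, [e h b W f] over [W' h e f b], is the
    shape that [sim_SB] resolves when [W] is a row of 2-blocks. *)
Lemma sim_32W3 U U' W W' (a b c d e f g h : T) :
  sim (U ++ [:: a; b; c; d; e] ++ W ++ [:: f; g; h]) (U' ++ [:: c; b; a; e; d] ++ W' ++ [:: h; g; f])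
      ([:: e; h; b] ++ W ++ [:: f; d] ++ U ++ [:: a; g; c]) (W' ++ [:: h; e; f; b; d] ++ U' ++ [:: c; g; a]).
Proof.
swap2 c h.
swap3' b e g.
swap2 a f.
swap2 d h.
exact: sim_refl.
Qed.

(** The 2-blocks [bc] and [de] leave the gap enclosed by [a] and [f] while the enclosure survives,
    so the step can be repeated on [V]. *)
Lemma sim_Y22 U U' V V' (a b c d e f : T) :
  sim (U ++ [:: a; b; c; d; e] ++ V ++ [:: f]) (U' ++ [:: f; c; b; e; d] ++ V' ++ [:: a])
      (U ++ [:: a] ++ V ++ [:: f; e; d; c; b]) (U' ++ [:: f] ++ V' ++ [:: a; d; e; b; c]).
Proof.
swap3 a c e.
swap3' f d b.
swap2 c e.
swap2 e a.
exact: sim_refl.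
Qed.

(** Two gaps trade places: [Z], enclosed by two letters, and [P], between that enclosure and the
    3-block. With one gap empty this gives the two directions of [[k+2, 3] <-> [2, k, 3]]. *)
Lemma sim_swapY_nil Z Z' P P' (a b c d e : T) :
  sim ([:: a] ++ Z ++ [:: b] ++ P ++ [:: c; d; e]) ([:: b] ++ Z' ++ [:: a] ++ P' ++ [:: e; d; c])
      ([:: e] ++ P ++ [:: c] ++ Z ++ [:: b; d; a]) ([:: c] ++ P' ++ [:: e] ++ Z' ++ [:: a; d; b]).
Proof.
swap2 a c.
swap3' e b a.
swap2 d c.
exact: sim_refl.
Qed.

Lemma sim_swapY_one U U' Z Z' P P' (a b c d e q : T) :
  sim (U ++ [:: q; a] ++ Z ++ [:: b] ++ P ++ [:: c; d; e]) (U' ++ [:: q; b] ++ Z' ++ [:: a] ++ P' ++ [:: e; d; c])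
      (U ++ [:: q; e] ++ P ++ [:: c] ++ Z ++ [:: b; d; a]) (U' ++ [:: q; c] ++ P' ++ [:: e] ++ Z' ++ [:: a; d; b]).
Proof.
swap2 a e.
swap2 b c.
swap2 d q.
swap2 e q.
exact: sim_refl.
Qed.

Lemma sim_4B_nil V V' (a b c d e f g : T) :
  sim ([:: a; b; c; d] ++ V ++ [:: e; f; g]) ([:: d; c; b; a] ++ V' ++ [:: g; f; e])
      ([:: b] ++ V ++ [:: e; d; g; a; f; c]) (V' ++ [:: g; d; e; b; c; f; a]).
Proof.
swap2 c g.
swap3' b d f.
swap2 a e.
exact: sim_refl.
Qed.

Lemma sim_4B_one U U' V V' (a b c d q x y z : T) :
  sim (U ++ [:: q; a; b; c; d] ++ V ++ [:: x; y; z]) (U' ++ [:: q; d; c; b; a] ++ V' ++ [:: z; y; x])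
      (U ++ [:: q; b] ++ V ++ [:: x; d; z; a; y; c]) (U' ++ [:: q] ++ V' ++ [:: z; d; x; b; c; y; a]).
Proof.
swap2 c z.
swap3' b d y.
swap2 a x.
swap2 z q.
exact: sim_refl.
Qed.

Lemma sim_B2_nil V V' (a b c d m n : T) :
  sim ([:: a; m; n] ++ V ++ [:: b; c; d]) ([:: n; m] ++ V' ++ [:: d; c; b; a])
      ([:: n; d; a] ++ V ++ [:: b; c; m]) (V' ++ [:: d; n; b; a; m; c]).
Proof.
swap3 a n c.
swap2 m d.
exact: sim_refl.
Qed.

Lemma sim_B2_one U U' V V' (a b c d m n q : T) :
  sim (U ++ [:: q; a; m; n] ++ V ++ [:: b; c; d]) (U' ++ [:: q; n; m] ++ V' ++ [:: d; c; b; a])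
      (U ++ [:: q; n; d; a] ++ V ++ [:: b; c; m]) (U' ++ [:: q] ++ V' ++ [:: d; n; b; a; m; c]).
Proof.
swap2 q m.
swap3 a n c.
swap2 m d.
exact: sim_refl.
Qed.

Lemma sim_S2_nil V V' (a b c d m n : T) :
  sim ([:: a; b; c; m; n] ++ V ++ [:: d]) ([:: n; m] ++ V' ++ [:: b; a; d; c])
      ([:: n] ++ V ++ [:: d; a; b; c; m]) (V' ++ [:: b; a; d; n; m; c]).
Proof.
swap2 m d.
exact: sim_refl.
Qed.

Lemma sim_S2_one U U' V V' (a b c d m n q : T) :
  sim (U ++ [:: q; a; b; c; m; n] ++ V ++ [:: d]) (U' ++ [:: q; n; m] ++ V' ++ [:: b; a; d; c])
      (U ++ [:: q; n] ++ V ++ [:: d; a; b; c; m]) (U' ++ [:: q] ++ V' ++ [:: b; a; d; n; m; c]).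
Proof.
swap2 m d.
swap2 d q.
exact: sim_refl.
Qed.

Lemma sim_234  (a b c d e f g h i : T) :
  sim ([:: a; b; c; d; e; f; g; h; i]) ([:: b; a; e; d; c; i; h; g; f])
      ([:: c; a; e; d; b; f; i; h; g]) ([:: a; c; b; d; e; i; f; g; h]).
Proof.
swap2 d h.
swap3' b e g.
swap3' d a f.
swap3' i e g.
swap2 h a.
swap2 e c.
exact: sim_refl.
Qed.

Lemma sim_1234 U U' (a b c d e f g h i j : T) :
  sim (U ++ [:: a; b; c; d; e; f; g; h; i; j]) (U' ++ [:: a; c; b; f; e; d; j; i; h; g])
      (U ++ [:: a; d; b; f; e; c; g; j; i; h]) (U' ++ [:: a; b; d; c; e; f; j; g; h; i]).
Proof.
swap2 f i.
swap3 h e j.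
swap3 g f d.
swap2 a c.
swap3' e b h.
swap2 i d.
exact: sim_refl.
Qed.

End Rules.

(** * Words cut into blocks, and relations between lists of block sizes *)

Section Append.
Variable T : Type.
Implicit Types (t b u v w : seq T).

Lemma sim_app t b t' b' u v : sim t b t' b' -> sim (t ++ u) (b ++ v) (t' ++ u) (b' ++ v).
Proof.
elim=> {t b t' b'}.
- by move=> t b; apply: sim_refl.
- by move=> t b t' b' _; apply: sim_sym.
- by move=> t b t' b' t'' b'' _ IH _; apply: sim_trans IH.
- move=> p x r y s p' r' s'; do !rewrite -!catA /=; exact: sim_swap2.
- move=> p x q y r z s p' q' r' s'; do !rewrite -!catA /=; exact: sim_swap3.
- move=> p x q y r z s p' q' r' s'; do !rewrite -!catA /=; exact: sim_swap3'.
Qed.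

Lemma sim_cast t b t' b' t1 b1 t1' b1' :
  sim t b t' b' -> t1 = t -> b1 = b -> t1' = t' -> b1' = b' -> sim t1 b1 t1' b1'.
Proof. by move=> ? -> -> -> ->. Qed.

Definition realizes (s : seq nat) t b :=
  exists cs : seq (seq T), [/\ map size cs = s, t = flatten cs & b = flatten (map rev cs)].

Lemma realizes_cat s1 s2 t b : realizes (s1 ++ s2) t b ->
  exists t1 b1 t2 b2, [/\ realizes s1 t1 b1, realizes s2 t2 b2, t = t1 ++ t2 & b = b1 ++ b2].
Proof.
case=> cs [Hs -> ->].
exists (flatten (take (size s1) cs)), (flatten (map rev (take (size s1) cs))).
exists (flatten (drop (size s1) cs)), (flatten (map rev (drop (size s1) cs))).
split.
- by exists (take (size s1) cs); split; rewrite // map_take Hs take_size_cat.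
- by exists (drop (size s1) cs); split; rewrite // map_drop Hs drop_size_cat.
- by rewrite -flatten_cat cat_take_drop.
- by rewrite -flatten_cat -map_cat cat_take_drop.
Qed.

Lemma realizes_catI s1 s2 t1 b1 t2 b2 :
  realizes s1 t1 b1 -> realizes s2 t2 b2 -> realizes (s1 ++ s2) (t1 ++ t2) (b1 ++ b2).
Proof.
move=> [c1 [<- -> ->]] [c2 [<- -> ->]]; exists (c1 ++ c2).
by rewrite !map_cat !flatten_cat.
Qed.

Lemma realizes_cons k s t b : realizes (k :: s) t b ->
  exists w t2 b2, [/\ size w = k, realizes s t2 b2, t = w ++ t2 & b = rev w ++ b2].
Proof.
case=> [[|w cs]] [] //= [<- <-] -> ->.
by exists w, (flatten cs), (flatten (map rev cs)); split=> //; exists cs.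
Qed.

Lemma realizes_nil t b : realizes [::] t b -> t = [::] /\ b = [::].
Proof. by case=> [[|w cs]] [] //= _ -> ->. Qed.

Lemma realizes0 : realizes [::] [::] [::].
Proof. by exists [::]. Qed.

Lemma realizes_blocks s u u' (cs : seq (seq T)) : realizes s u u' ->
  realizes (s ++ map size cs) (u ++ flatten cs) (u' ++ flatten (map rev cs)).
Proof. by move=> H; apply: realizes_catI => //; exists cs. Qed.

(* Lists may contain zeros: a rule such as [2, k+4 -> 4, k, 2] then also covers
   [k = 0]. *)
Definition lsim (s s' : seq nat) := forall t b, realizes s t b ->
  exists t' b', realizes s' t' b' /\ sim t b t' b'.

Lemma lsim_refl s : lsim s s.
Proof. by move=> t b H; exists t, b; split=> //; apply: sim_refl. Qed.

Lemma lsim_trans s2 s1 s3 : lsim s1 s2 -> lsim s2 s3 -> lsim s1 s3.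
Proof.
move=> H1 H2 t b /H1 [t' [b' [/H2 [t'' [b'' [H S2]]] S1]]].
by exists t'', b''; split=> //; apply: sim_trans S1 S2.
Qed.

Lemma lsim_cat r s s' : lsim s s' -> lsim (s ++ r) (s' ++ r).
Proof.
move=> H t b /realizes_cat [t1 [b1 [t2 [b2 [/H [t' [b' [H' S]]] Hu -> ->]]]]].
exists (t' ++ t2), (b' ++ b2); split; first exact: realizes_catI.
exact: sim_app.
Qed.

Lemma lsim_drop0 U V : lsim (U ++ 0 :: V) (U ++ V).
Proof.
move=> t b /realizes_cat [t1 [b1 [t2 [b2 [H1 /realizes_cons]]]]].
case=> w [t3 [b3 [/size0nil -> H3 -> ->]]] -> ->.
by exists (t1 ++ t3), (b1 ++ b3); split; [exact: realizes_catI|exact: sim_refl].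
Qed.

Lemma size1P w : size w = 1 -> exists a, w = [:: a].
Proof. by case: w => [|a []] // _; exists a. Qed.

Lemma size2P w : size w = 2 -> exists (a b : T), w = [:: a; b].
Proof. by case: w => [|a [|b []]] // _; exists a, b. Qed.

Lemma size3P w : size w = 3 -> exists (a b c : T), w = [:: a; b; c].
Proof. by case: w => [|a [|b [|c []]]] // _; exists a, b, c. Qed.

Lemma size4P w : size w = 4 -> exists (a b c d : T), w = [:: a; b; c; d].
Proof. by case: w => [|a [|b [|c [|d []]]]] // _; exists a, b, c, d. Qed.

Lemma size5P w : size w = 5 -> exists (a b c d e : T), w = [:: a; b; c; d; e].
Proof. by case: w => [|a [|b [|c [|d [|e []]]]]] // _; exists a, b, c, d, e. Qed.

Lemma size_ends1P n w : size w = n.+2 -> exists (a : T) z (b : T), w = a :: z ++ [:: b] /\ size z = n.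
Proof.
case: w => [|a w] //; case/lastP: w => [|w b] //; rewrite /= size_rcons => -[<-].
by exists a, w, b; rewrite cats1.
Qed.

Lemma size_ends2P n w : size w = n.+4 ->
  exists (a b : T) z (c d : T), w = a :: b :: z ++ [:: c; d] /\ size z = n.
Proof.
case/size_ends1P=> a [z [d [-> /size_ends1P [b [y [c [-> <-]]]]]]].
by exists a, b, y, c, d; rewrite /= -catA.
Qed.

Lemma rev0 : rev [::] = [::] :> seq T. Proof. by []. Qed.

End Append.

Ltac words_solve :=
  do ![progress rewrite ?rev_cons ?rev_cat ?rev0 -?cats1 /= ?cats0 -?catA /=]; by [].

(** * Rules on lists of block sizes *)

Section ListRules.
Variable T : Type.
Notation lsim := (lsim T).

(** Two letters are split off at each end of the long block, and the [n] letters [z] between them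
    are carried along as a block of their own. All rules for [n.+4] work in this way, which is why
    long blocks are lowered by 4. *)
Lemma lsim_2k U n : lsim (U ++ [:: 2; n.+4]) (U ++ [:: 4; n; 2]).
Proof.
move=> t s /realizes_cat [u [u' [t1 [b1 [Hu /realizes_cons]]]]].
case=> w [? [? [/size2P [a [b ->]] /realizes_cons]]].
case=> {}w [? [? [/size_ends2P [c [d [z [e [f [-> <-]]]]]] /realizes_nil [-> ->]]]] -> -> -> -> -> ->.
have H := realizes_blocks [:: [:: a; f; c; b]; z; [:: e; d]] Hu.
do 2!eexists; split; first by exact: H.
by apply: sim_cast (sim_2k u u' z (rev z) a b c d e f) _ _ _ _; words_solve.
Qed.

Lemma lsim_k2 U n : lsim (U ++ [:: n.+4; 2]) (U ++ [:: 2; n; 4]).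
Proof.
move=> t s /realizes_cat [u [u' [t1 [b1 [Hu /realizes_cons]]]]].
case=> w [? [? [/size_ends2P [a [b [z [c [d [-> <-]]]]]] /realizes_cons]]].
case=> {}w [? [? [/size2P [e [f ->]] /realizes_nil [-> ->]]]] -> -> -> -> -> ->.
have H := realizes_blocks [:: [:: a; d]; z; [:: c; f; e; b]] Hu.
do 2!eexists; split; first by exact: H.
by apply: sim_cast (sim_k2 u u' z (rev z) a b c d e f) _ _ _ _; words_solve.
Qed.

Lemma lsim_4k U n : lsim (U ++ [:: 4; n.+4]) (U ++ [:: 2; 2; 2; n; 2]).
Proof.
move=> t s /realizes_cat [u [u' [t1 [b1 [Hu /realizes_cons]]]]].
case=> w [? [? [/size4P [a [b [c [d ->]]]] /realizes_cons]]].
case=> {}w [? [? [/size_ends2P [e [f [z [g [h [-> <-]]]]]] /realizes_nil [-> ->]]]] -> -> -> -> -> ->.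
have H := realizes_blocks [:: [:: a; d]; [:: c; b]; [:: e; h]; z; [:: g; f]] Hu.
do 2!eexists; split; first by exact: H.
by apply: sim_cast (sim_4k u u' z (rev z) a b c d e f g h) _ _ _ _; words_solve.
Qed.

Lemma lsim_k12 U n : lsim (U ++ [:: n.+4; 1; 2]) (U ++ [:: 2; n; 5]).
Proof.
move=> t s /realizes_cat [u [u' [t1 [b1 [Hu /realizes_cons]]]]].
case=> w [? [? [/size_ends2P [a [b [z [c [d [-> <-]]]]]] /realizes_cons]]].
case=> {}w [? [? [/size1P [e ->] /realizes_cons]]].
case=> {}w [? [? [/size2P [f [g ->]] /realizes_nil [-> ->]]]] -> -> -> -> -> -> -> ->.
have H := realizes_blocks [:: [:: a; d]; z; [:: c; g; e; f; b]] Hu.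
do 2!eexists; split; first by exact: H.
by apply: sim_cast (sim_k12 u u' z (rev z) a b c d e f g) _ _ _ _; words_solve.
Qed.

Lemma lsim_k13 U n : lsim (U ++ [:: n.+4; 1; 3]) (U ++ [:: 2; n; 2; 1; 3]).
Proof.
move=> t s /realizes_cat [u [u' [t1 [b1 [Hu /realizes_cons]]]]].
case=> w [? [? [/size_ends2P [a [b [z [c [d [-> <-]]]]]] /realizes_cons]]].
case=> {}w [? [? [/size1P [e ->] /realizes_cons]]].
case=> {}w [? [? [/size3P [f [g [h ->]]] /realizes_nil [-> ->]]]] -> -> -> -> -> -> -> ->.
have H := realizes_blocks [:: [:: a; d]; z; [:: c; b]; [:: e]; [:: h; g; f]] Hu.
do 2!eexists; split; first by exact: H.
by apply: sim_cast (sim_k13 u u' z (rev z) a b c d e f g h) _ _ _ _; words_solve.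
Qed.

Lemma lsim_53 U : lsim (U ++ [:: 5; 3]) (U ++ [:: 2; 1; 2; 3]).
Proof.
move=> t s /realizes_cat [u [u' [t1 [b1 [Hu /realizes_cons]]]]].
case=> w [? [? [/size5P [a [b [c [d [e ->]]]]] /realizes_cons]]].
case=> {}w [? [? [/size3P [f [g [h ->]]] /realizes_nil [-> ->]]]] -> -> -> -> -> ->.
have H := realizes_blocks [:: [:: a; e]; [:: c]; [:: f; d]; [:: h; g; b]] Hu.
do 2!eexists; split; first by exact: H.
by apply: sim_cast (sim_53 u u' a b c d e f g h) _ _ _ _; words_solve.
Qed.

Lemma lsim_35 U : lsim (U ++ [:: 3; 5]) (U ++ [:: 3; 2; 1; 2]).
Proof.
move=> t s /realizes_cat [u [u' [t1 [b1 [Hu /realizes_cons]]]]].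
case=> w [? [? [/size3P [a [b [c ->]]] /realizes_cons]]].
case=> {}w [? [? [/size5P [d [e [f [g [h ->]]]]] /realizes_nil [-> ->]]]] -> -> -> -> -> ->.
have H := realizes_blocks [:: [:: a; d; c]; [:: f; b]; [:: h]; [:: g; e]] Hu.
do 2!eexists; split; first by exact: H.
by apply: sim_cast (sim_35 u u' a b c d e f g h) _ _ _ _; words_solve.
Qed.

Lemma lsim_414 U : lsim (U ++ [:: 4; 1; 4]) (U ++ [:: 2; 2; 1; 2; 2]).
Proof.
move=> t s /realizes_cat [u [u' [t1 [b1 [Hu /realizes_cons]]]]].
case=> w [? [? [/size4P [a [b [c [d ->]]]] /realizes_cons]]].
case=> {}w [? [? [/size1P [e ->] /realizes_cons]]].
case=> {}w [? [? [/size4P [f [g [h [i ->]]]] /realizes_nil [-> ->]]]] -> -> -> -> -> -> -> ->.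
have H := realizes_blocks [:: [:: a; d]; [:: c; b]; [:: e]; [:: f; i]; [:: h; g]] Hu.
do 2!eexists; split; first by exact: H.
by apply: sim_cast (sim_414 u u' a b c d e f g h i) _ _ _ _; words_solve.
Qed.

(** Of the two adjacent 3-blocks only one remains, and a new chain made of one 2-block opens in
    front of [U]: unlike the rules above, this one moves the prefix. *)
Lemma lsim_2233 U : lsim (U ++ [:: 2; 2; 3; 3]) ([:: 2; 1] ++ U ++ [:: 4; 3]).
Proof.
move=> t s /realizes_cat [u [u' [t1 [b1 [Hu /realizes_cons]]]]].
case=> w [? [? [/size2P [a [b ->]] /realizes_cons]]].
case=> {}w [? [? [/size2P [c [d ->]] /realizes_cons]]].
case=> {}w [? [? [/size3P [e [f [g ->]]] /realizes_cons]]].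
case=> {}w [? [? [/size3P [h [i [j ->]]] /realizes_nil [-> ->]]]] -> -> -> -> -> -> -> -> -> ->.
have H := realizes_catI (realizes_blocks [:: [:: j; h]; [:: f]] (realizes0 T)) (realizes_blocks [:: [:: a; d; c; b]; [:: e; i; g]] Hu).
do 2!eexists; split; first by exact: H.
by apply: sim_cast (sim_2233 u u' a b c d e f g h i j) _ _ _ _; words_solve.
Qed.

End ListRules.

(* What follows [P] starts a new chain. *)
Definition chain_start (P : seq nat) := (P == [::]) || (last 0 P == 1).

(** * Rules that hold at the start of a chain *)

Section Prefix.
Variable T : Type.
Implicit Types (U V W Z P : seq T).
Notation lsim := (lsim T).

(** [q] is the letter of the 1-block that ends the prefix in both words; in the [_one] rules
    exchanges with it put the prefix back in front. *)
Definition word_start U U' :=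
  (U = [::] /\ U' = [::]) \/ exists u u' q, U = u ++ [:: q] /\ U' = u' ++ [:: q].

Lemma realizes_start s U U' : chain_start s -> realizes s U U' -> word_start U U'.
Proof.
case/orP=> [/eqP-> /realizes_nil|]; first by left.
case/lastP: s => [//|s x]; rewrite last_rcons => /eqP -> {x}; rewrite -cats1.
case/realizes_cat=> u [u' [t [b [_ /realizes_cons]]]].
case=> w [? [? [/size1P [q ->] /realizes_nil [-> ->] -> ->]]] -> ->.
by right; exists u, u', q.
Qed.

Lemma sim_swapY U U' Z Z' P P' (a b c d e : T) : word_start U U' ->
  sim (U ++ a :: Z ++ b :: P ++ [:: c; d; e]) (U' ++ b :: Z' ++ a :: P' ++ [:: e; d; c])
      (U ++ e :: P ++ c :: Z ++ [:: b; d; a]) (U' ++ c :: P' ++ e :: Z' ++ [:: a; d; b]).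
Proof.
case=> [[-> ->]|[u [u' [q [-> ->]]]]]; first exact: sim_swapY_nil.
by apply: sim_cast (sim_swapY_one u u' Z Z' P P' a b c d e q) _ _ _ _; words_solve.
Qed.

Lemma sim_4B U U' V V' (a b c d x y z : T) : word_start U U' ->
  exists a1 b1 c1 d1 x1 y1 z1,
  sim (U ++ [:: a; b; c; d] ++ V ++ [:: x; y; z]) (U' ++ [:: d; c; b; a] ++ V' ++ [:: z; y; x])
    ((U ++ a1 :: V ++ [:: b1; c1; d1]) ++ [:: x1; y1; z1])
    ((U' ++ V' ++ [:: d1; c1; b1; a1]) ++ [:: z1; y1; x1]).
Proof.
case=> [[-> ->]|[u [u' [q [-> ->]]]]]; do 7!eexists.
  by apply: sim_cast (sim_4B_nil V V' a b c d x y z) _ _ _ _; words_solve.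
by apply: sim_cast (sim_4B_one u u' V V' a b c d q x y z) _ _ _ _; words_solve.
Qed.

Lemma sim_B2 U U' V V' (a b c d m n : T) : word_start U U' ->
  exists a1 b1 c1 d1 x1 y1,
  sim (U ++ a :: [:: m; n] ++ V ++ [:: b; c; d]) (U' ++ [:: n; m] ++ V' ++ [:: d; c; b; a])
    ((U ++ [:: a1; b1; c1] ++ V ++ [:: d1]) ++ [:: x1; y1])
    ((U' ++ V' ++ [:: b1; a1; d1; c1]) ++ [:: y1; x1]).
Proof.
case=> [[-> ->]|[u [u' [q [-> ->]]]]]; do 6!eexists.
  by apply: sim_cast (sim_B2_nil V V' a b c d m n) _ _ _ _; words_solve.
by apply: sim_cast (sim_B2_one u u' V V' a b c d m n q) _ _ _ _; words_solve.
Qed.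

Lemma sim_S2 U U' V V' (a b c d m n : T) : word_start U U' ->
  exists a1 b1 c1 d1 x1 y1,
  sim (U ++ [:: a; b; c] ++ [:: m; n] ++ V ++ [:: d]) (U' ++ [:: n; m] ++ V' ++ [:: b; a; d; c])
    ((U ++ a1 :: V ++ [:: b1; c1; d1]) ++ [:: x1; y1])
    ((U' ++ V' ++ [:: d1; c1; b1; a1]) ++ [:: y1; x1]).
Proof.
case=> [[-> ->]|[u [u' [q [-> ->]]]]]; do 6!eexists.
  by apply: sim_cast (sim_S2_nil V V' a b c d m n) _ _ _ _; words_solve.
by apply: sim_cast (sim_S2_one u u' V V' a b c d m n q) _ _ _ _; words_solve.
Qed.

Definition sim_realizes (t b : seq T) (s : seq nat) := exists t' b', realizes s t' b' /\ sim t b t' b'.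

Lemma sim_realizes_trans t b t' b' s : sim t b t' b' -> sim_realizes t' b' s -> sim_realizes t b s.
Proof. by move=> H [t1 [b1 [Hr Hs]]]; exists t1, b1; split=> //; apply: sim_trans Hs. Qed.

Lemma sim_realizes_cat t b s w w' r :
  sim_realizes t b s -> realizes r w w' -> sim_realizes (t ++ w) (b ++ w') (s ++ r).
Proof.
move=> [t1 [b1 [Hr Hs]]] Hw; exists (t1 ++ w), (b1 ++ w').
by split; [apply: realizes_catI|apply: sim_app].
Qed.

Lemma realizes_blk (w : seq T) : realizes [:: size w] w (rev w).
Proof. by exists [:: w]; rewrite /= !cats0. Qed.

(* A 4-block is carried across a row of 2-blocks, alternating at each 2-block
   between its shape [abcd/dcba] and a pair of 2-blocks [abcd/badc]; hence the
   parity of [m]. *)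
Lemma sim_SB U U' s V V' m : word_start U U' -> realizes s U U' ->
  realizes (nseq m 2) V V' ->
  (forall a b c d : T, sim_realizes (U ++ [:: a; b; c] ++ V ++ [:: d]) (U' ++ V' ++ [:: b; a; d; c])
     (s ++ if odd m then 4 :: nseq m 2 else nseq m.+2 2)) /\
  (forall a b c d : T, sim_realizes (U ++ a :: V ++ [:: b; c; d]) (U' ++ V' ++ [:: d; c; b; a])
     (s ++ if odd m then nseq m.+2 2 else 4 :: nseq m 2)).
Proof.
move=> HU Hs; elim: m V V' => [|m IH] V V'.
  case/realizes_nil=> -> ->; split=> a b c d /=.
    exists (U ++ [:: a; b; c; d]), (U' ++ [:: b; a; d; c]); split; last exact: sim_refl.
    exact: (realizes_blocks [:: [:: a; b]; [:: c; d]] Hs).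
  exists (U ++ [:: a; b; c; d]), (U' ++ [:: d; c; b; a]); split; last exact: sim_refl.
  exact: (realizes_blocks [:: [:: a; b; c; d]] Hs).
case/realizes_cons=> w [V1 [V1' [/size2P [x [y ->]] /IH [IHS IHB] -> ->]]].
split=> a b c d.
  have [a1 [b1 [c1 [d1 [x1 [y1 H]]]]]] := sim_S2 V1 V1' a b c d x y HU.
  have := sim_realizes_cat (IHB a1 b1 c1 d1) (realizes_blk [:: x1; y1]).
  rewrite (_ : (s ++ _) ++ _ = s ++ if odd m.+1 then 4 :: nseq m.+1 2 else nseq m.+3 2).
    by apply: sim_realizes_trans; apply: sim_cast H _ _ _ _; words_solve.
  rewrite -catA /=; case: (odd m) => /=; congr (_ ++ _); rewrite ?cat_cons.
    by rewrite -[nseq m 2 ++ _]/(nseq m 2 ++ nseq 1 2) -nseqD addn1.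
  by rewrite -[nseq m 2 ++ _]/(nseq m 2 ++ nseq 1 2) -nseqD addn1.
have [a1 [b1 [c1 [d1 [x1 [y1 H]]]]]] := sim_B2 V1 V1' a b c d x y HU.
have := sim_realizes_cat (IHS a1 b1 c1 d1) (realizes_blk [:: x1; y1]).
rewrite (_ : (s ++ _) ++ _ = s ++ if odd m.+1 then nseq m.+3 2 else 4 :: nseq m.+1 2).
  by apply: sim_realizes_trans; apply: sim_cast H _ _ _ _; words_solve.
rewrite -catA /=; case: (odd m) => /=; congr (_ ++ _); rewrite ?cat_cons.
  by rewrite -[nseq m 2 ++ _]/(nseq m 2 ++ nseq 1 2) -nseqD addn1.
by rewrite -[nseq m 2 ++ _]/(nseq m 2 ++ nseq 1 2) -nseqD addn1.
Qed.

(** [sim_Y22] removes 2-blocks two at a time, whence the parity condition; at the end [a] and [b]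
    are adjacent and form one more 2-block. *)
Lemma sim_Y U U' s V V' m (a b : T) : ~~ odd m -> realizes s U U' ->
  realizes (nseq m 2) V V' ->
  sim_realizes (U ++ a :: V ++ [:: b]) (U' ++ b :: V' ++ [:: a]) (s ++ nseq m.+1 2).
Proof.
rewrite -{2 3}[m]odd_double_half => /negPf -> Hs; rewrite add0n.
elim: (m./2) V V' a b => [|i IH] V V' a b.
  case/realizes_nil=> -> ->; exists (U ++ [:: a; b]), (U' ++ [:: b; a]).
  by split; [exact: (realizes_blocks [:: [:: a; b]] Hs)|exact: sim_refl].
rewrite doubleS.
case/realizes_cons=> w [? [? [/size2P [c [d ->]] /realizes_cons]]].
case=> {}w [V1 [V1' [/size2P [e [f ->]] HV -> ->]]] -> ->.
have := sim_realizes_cat (sim_realizes_cat (IH _ _ a b HV) (realizes_blk [:: f; e])) (realizes_blk [:: d; c]).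
rewrite (_ : ((s ++ _) ++ _) ++ _ = s ++ nseq i.*2.+3 2); last first.
  by rewrite -!catA -[X in s ++ X]/(nseq i.*2.+1 2 ++ nseq 2 2) -nseqD addn2.
by apply: sim_realizes_trans; apply: sim_cast (sim_Y22 U U' V1 V1' a c d e f b) _ _ _ _; words_solve.
Qed.

End Prefix.

Lemma cat_nseqS (m : nat) r : nseq m 2 ++ 2 :: r = nseq m.+1 2 ++ r.
Proof. by elim: m => //= m ->. Qed.

(** * Moving and dissolving 3- and 4-blocks *)

Section Lists.
Variable T : Type.
Notation lsim := (lsim T).
Implicit Types (U P r s : seq nat).

Lemma lsim_suffix U s s' r : lsim (U ++ s) (U ++ s') -> lsim (U ++ s ++ r) (U ++ s' ++ r).
Proof. by rewrite ![U ++ _ ++ r]catA; apply: lsim_cat. Qed.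

Lemma lsim_42 U r : lsim (U ++ 4 :: 2 :: r) (U ++ 2 :: 4 :: r).
Proof.
apply: (@lsim_suffix U [:: 4; 2] [:: 2; 4]).
apply: lsim_trans (@lsim_k2 T _ 0) _.
by have := @lsim_drop0 T (U ++ [:: 2]) [:: 4]; rewrite -!catA.
Qed.

Lemma lsim_24 U r : lsim (U ++ 2 :: 4 :: r) (U ++ 4 :: 2 :: r).
Proof.
apply: (@lsim_suffix U [:: 2; 4] [:: 4; 2]).
apply: lsim_trans (@lsim_2k T _ 0) _.
by have := @lsim_drop0 T (U ++ [:: 4]) [:: 2]; rewrite -!catA.
Qed.

Lemma lsim_42s U m r : lsim (U ++ 4 :: nseq m 2 ++ r) (U ++ nseq m 2 ++ 4 :: r).
Proof.
elim: m U => [|m IH] U /=; first exact: lsim_refl.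
apply: lsim_trans (@lsim_42 _ _) _.
by have := IH (U ++ [:: 2]); rewrite -!catA.
Qed.

Lemma lsim_2s4 U m r : lsim (U ++ nseq m 2 ++ 4 :: r) (U ++ 4 :: nseq m 2 ++ r).
Proof.
elim: m U => [|m IH] U /=; first exact: lsim_refl.
apply: lsim_trans (@lsim_24 _ _).
by have := IH (U ++ [:: 2]); rewrite -!catA.
Qed.

(** A single two-letter exchange at the letters of the two 1-blocks. All chains but the last can be
    permuted by it. *)
Lemma lsim_swap A B C : lsim (A ++ 1 :: B ++ 1 :: C) (B ++ 1 :: A ++ 1 :: C).
Proof.
move=> t b /realizes_cat [a [a' [? [? [HA /realizes_cons]]]]].
case=> w [? [? [/size1P [x ->] /realizes_cat]]].
case=> [d [d' [? [? [HB /realizes_cons]]]]].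
case=> {}w [c [c' [/size1P [y ->] HC -> ->]]] -> -> -> -> -> ->.
exists (d ++ [:: y] ++ a ++ [:: x] ++ c), (d' ++ [:: y] ++ a' ++ [:: x] ++ c').
split; last exact: sim_swap2.
have R1 (z : T) : realizes [:: 1] [:: z] [:: z] by exists [:: [:: z]].
exact: (realizes_catI HB (realizes_catI (R1 y) (realizes_catI HA (realizes_catI (R1 x) HC)))).
Qed.

Lemma lsim_k3 P k r : chain_start P -> lsim (P ++ k.+2 :: 3 :: r) (P ++ 2 :: k :: 3 :: r).
Proof.
move=> HP; apply: (@lsim_suffix P [:: k.+2; 3] [:: 2; k; 3]).
move=> t s /realizes_cat [u [u' [? [? [Hu /realizes_cons]]]]].
case=> w [? [? [/size_ends1P [a [z [b [-> <-]]]] /realizes_cons]]].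
case=> {}w [? [? [/size3P [c [d [e ->]]] /realizes_nil [-> ->]]]] -> -> -> -> -> ->.
have H := realizes_blocks [:: [:: e; c]; z; [:: b; d; a]] Hu.
do 2!eexists; split; first by exact: H.
by apply: sim_cast (sim_swapY z (rev z) [::] [::] a b c d e (realizes_start HP Hu))
  _ _ _ _; words_solve.
Qed.

Lemma lsim_2k3 P k r : chain_start P -> lsim (P ++ 2 :: k :: 3 :: r) (P ++ k.+2 :: 3 :: r).
Proof.
move=> HP; apply: (@lsim_suffix P [:: 2; k; 3] [:: k.+2; 3]).
move=> t s /realizes_cat [u [u' [? [? [Hu /realizes_cons]]]]].
case=> w [? [? [/size2P [a [b ->]] /realizes_cons]]].
case=> z [? [? [<- /realizes_cons]]].
case=> {}w [? [? [/size3P [c [d [e ->]]] /realizes_nil [-> ->]]]] -> -> -> -> -> -> -> ->.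
have := realizes_blocks [:: e :: z ++ [:: c]; [:: b; d; a]] Hu.
rewrite /= size_cat /= addn1 => H.
do 2!eexists; split; first by exact: H.
by apply: sim_cast (sim_swapY [::] [::] z (rev z) a b c d e (realizes_start HP Hu))
  _ _ _ _; words_solve.
Qed.

(** The parity of [m] selects the route. For odd [m], [sim_4B] leaves a 4-block shape spread around
    the 2-blocks, which [sim_SB] turns into 2-blocks only. For even [m], [sim_swapY] encloses the
    2-blocks between two letters, which [sim_Y] resolves; the inner letters [bc] of the 4-block
    become a 2-block. *)
Lemma lsim_4_2s3 P m r : chain_start P ->
  lsim (P ++ 4 :: nseq m 2 ++ 3 :: r) (P ++ nseq m.+2 2 ++ 3 :: r).
Proof.
move=> HP; have := @lsim_suffix P (4 :: nseq m 2 ++ [:: 3]) (nseq m.+2 2 ++ [:: 3]) r.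
rewrite /= -!catA; apply.
move=> t s /realizes_cat [u [u' [? [? [Hu /realizes_cons]]]]].
case=> w [? [? [/size4P [a [b [c [d ->]]]] /realizes_cat]]].
case=> [V [V' [? [? [HV /realizes_cons]]]]].
case=> {}w [? [? [/size3P [x [y [z ->]]] /realizes_nil [-> ->]]]] -> -> -> -> -> -> -> ->.
have Hp := realizes_start HP Hu.
rewrite (_ : P ++ _ = (P ++ nseq m.+2 2) ++ [:: 3]); last by rewrite -catA.
case Om: (odd m).
  have [a1 [b1 [c1 [d1 [x1 [y1 [z1 H]]]]]]] := sim_4B V V' a b c d x y z Hp.
  have [_ HB] := sim_SB Hp Hu HV.
  have := sim_realizes_cat (HB a1 b1 c1 d1) (realizes_blk [:: x1; y1; z1]).
  by rewrite Om; apply: sim_realizes_trans; apply: sim_cast H _ _ _ _; words_solve.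
have H := sim_swapY [:: b; c] [:: c; b] V V' a d x y z Hp.
have HY := sim_Y z x (negbT Om) Hu HV.
have := sim_realizes_cat (sim_realizes_cat HY (realizes_blk [:: b; c])) (realizes_blk [:: d; y; a]).
rewrite (_ : ((P ++ _) ++ _) ++ _ = (P ++ nseq m.+2 2) ++ [:: 3]); last first.
  by rewrite -!catA [nseq _ _ ++ _]cat_nseqS.
by apply: sim_realizes_trans; apply: sim_cast H _ _ _ _; words_solve.
Qed.

(** The 2-block next to the first 3-block supplies the new 1-block; the other [l] 2-blocks go to the
    front, in the shape of [sim_SB], whose parity rule explains the case distinction. Only one of
    the two 3-blocks is left. *)
Lemma lsim_3_2s3 U l r : lsim (U ++ 3 :: nseq l.+1 2 ++ 3 :: r)
  ((if odd l then 4 :: nseq l 2 else nseq l.+2 2) ++ 1 :: U ++ 3 :: r).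
Proof.
have := @lsim_cat T r (U ++ 3 :: 2 :: nseq l 2 ++ [:: 3])
  ((if odd l then 4 :: nseq l 2 else nseq l.+2 2) ++ 1 :: U ++ [:: 3]).
rewrite -!catA /= -!catA /=; apply.
move=> t s /realizes_cat [u [u' [? [? [Hu /realizes_cons]]]]].
case=> w [? [? [/size3P [a [b [c ->]]] /realizes_cons]]].
case=> {}w [? [? [/size2P [d [e ->]] /realizes_cat]]].
case=> [V [V' [? [? [HV /realizes_cons]]]]].
case=> {}w [? [? [/size3P [f [g [h ->]]] /realizes_nil [-> ->]]]].
do 10!move=> ->.
have H := sim_32W3 u u' V V' a b c d e f g h.
have Hp : word_start [::] ([::] : seq T) by left.
have [/(_ e h b f) HS _] := sim_SB Hp (realizes0 T) HV.
have := sim_realizes_cat (sim_realizes_cat (sim_realizes_cat HS (realizes_blk [:: d])) Hu) (realizes_blk [:: a; g; c]).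
rewrite -!catA /=.
by apply: sim_realizes_trans; apply: sim_cast H _ _ _ _; words_solve.
Qed.

Lemma lsim_234 P r : chain_start P -> lsim (P ++ 2 :: 3 :: 4 :: r) (P ++ 2 :: 3 :: 2 :: 2 :: r).
Proof.
move=> HP; apply: (@lsim_suffix P [:: 2; 3; 4] [:: 2; 3; 2; 2]).
move=> t s /realizes_cat [u [u' [? [? [Hu /realizes_cons]]]]].
case=> w [? [? [/size2P [a [b ->]] /realizes_cons]]].
case=> {}w [? [? [/size3P [c [d [e ->]]] /realizes_cons]]].
case=> {}w [? [? [/size4P [f [g [h [i ->]]]] /realizes_nil [-> ->]]]].
do 8!move=> ->.
have Hp := realizes_start HP Hu.
case: Hp Hu => [[-> ->]|[v [v' [q [-> ->]]]]] Hu.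
  have H := realizes_blocks [:: [:: c; a]; [:: e; d; b]; [:: f; i]; [:: h; g]] Hu.
  do 2!eexists; split; first by exact: H.
  by apply: sim_cast (sim_234 a b c d e f g h i) _ _ _ _; words_solve.
have H := realizes_blocks [:: [:: c; a]; [:: e; d; b]; [:: f; i]; [:: h; g]] Hu.
do 2!eexists; split; first by exact: H.
by apply: sim_cast (sim_1234 v v' q a b c d e f g h i) _ _ _ _; words_solve.
Qed.

End Lists.

Lemma cat_nseq2 m r : nseq m 2 ++ 2 :: r = 2 :: nseq m 2 ++ r.
Proof. by elim: m => //= m ->. Qed.

Ltac lists_eq :=
  rewrite /= ?nseqD; do ?[progress rewrite -?catA /= ?cat_nseq2 ?cats0 /=]; by [].

(** * How chains behave under concatenation, and further rules across 1-blocks *)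

Lemma chains_neq0 s : chains s = head [::] (chains s) :: behead (chains s).
Proof. by case: s => //= x s; case: ifP. Qed.

Lemma chains_cat1 s t : chains (s ++ 1 :: t) = chains s ++ chains t.
Proof. by elim: s => //= x s ->; case: (x == 1); rewrite // chains_neq0. Qed.

Lemma chains_no1 s : 1 \notin s -> chains s = [:: s].
Proof. by elim: s => //= x s IH; rewrite inE negb_or eq_sym => /andP [/negPf-> /IH->]. Qed.

Lemma chains_start P : chain_start P -> exists cs, forall s, chains (P ++ s) = cs ++ chains s.
Proof.
case/orP=> [/eqP->|]; first by exists [::].
case/lastP: P => [//|P x]; rewrite last_rcons => /eqP->; exists (chains P) => s.
by rewrite cat_rcons chains_cat1.
Qed.

Lemma all_chains (p : pred nat) s : all (all p) (chains s) = all (fun x => (x == 1) || p x) s.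
Proof.
elim: s => //= x s <-; case: (x == 1) => //=.
case: (chains s) (erefl (chains s)) => [|c cs] _ /=; first by rewrite !andbT.
by rewrite andbA.
Qed.

(** Types 2, 3 and 4 are grouped because appending a 1-block or a 2-block does not lead out of the
    group; Types 1 and 5 need arguments of their own. *)
Definition type234 s := [|| type2 s, type3 s | type4 s].

Arguments lsim_cat {T} r {s s'} _ [t b] _.

Section Lists.
Variable T : Type.
Notation lsim := (lsim T).
Implicit Types (U P r s : seq nat).

Lemma lsim_step s s' s1 s2 : lsim s s' -> s1 = s -> lsim s' s2 -> lsim s1 s2.
Proof. by move=> H ->; apply: lsim_trans. Qed.

Lemma lsim_eq s s' : s = s' -> lsim s s'.
Proof. by move=> ->; apply: lsim_refl. Qed.

Lemma lsim_k2V U n : lsim (U ++ [:: 2; n; 4]) (U ++ [:: n.+4; 2]).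
Proof.
move=> t s /realizes_cat [u [u' [? [? [Hu /realizes_cons]]]]].
case=> w [? [? [/size2P [a [d ->]] /realizes_cons]]].
case=> z [? [? [<- /realizes_cons]]].
case=> {}w [? [? [/size4P [c [f [e [b ->]]]] /realizes_nil [-> ->]]]].
do 8!move=> ->.
have := realizes_blocks [:: a :: b :: z ++ [:: c; d]; [:: e; f]] Hu.
rewrite /= size_cat /= addn2 => H.
do 2!eexists; split; first by exact: H.
by apply: sim_cast (sim_sym (sim_k2 u u' z (rev z) a b c d e f)) _ _ _ _; words_solve.
Qed.

(** If a second 2-block is available, [[2, 3, 4]] is merged into [[7, 2]] and [[2, 7]] is split
    again as [[4, 3, 2]]. The 4-block is now on the left of the 3-block, moves to the start of the
    chain and dissolves. A single 2-block needs the separate rule [lsim_234]. *)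
Lemma lsim_34 P a r : chain_start P ->
  lsim (P ++ nseq a.+1 2 ++ 3 :: 4 :: r) (P ++ nseq a.+1 2 ++ 3 :: 2 :: 2 :: r).
Proof.
move=> HP; case: a => [|a]; first exact: lsim_234.
apply: (lsim_step (lsim_cat r (@lsim_k2V (P ++ nseq a.+1 2) 3))); first lists_eq.
apply: (lsim_step (lsim_cat (2 :: r) (@lsim_2k T (P ++ nseq a 2) 3))); first lists_eq.
apply: (lsim_step (@lsim_2s4 T P a (3 :: 2 :: 2 :: r))); first lists_eq.
by apply: (lsim_step (@lsim_4_2s3 T P a (2 :: 2 :: r) HP)); [|apply: lsim_eq]; lists_eq.
Qed.

(** The 4-block crosses the 1-block in disguise: [[4, 1, 2]] becomes [[2, 5]], and the 5-block
    restores a 1-block through [[5, 3]] or [[5, 2]]. The latter gives [[2, 1, 4]], with the 4-block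
    now in the chain of the 3-block, where it dissolves. For [j = 0] one rule suffices. *)
Lemma lsim_4_1_3 U i j : lsim (U ++ 4 :: nseq i 2 ++ 1 :: nseq j 2 ++ [:: 3])
  (U ++ nseq i.+2 2 ++ 1 :: nseq j 2 ++ [:: 3]).
Proof.
apply: (lsim_step (@lsim_42s T U i (1 :: nseq j 2 ++ [:: 3]))); first lists_eq.
case: j => [|j].
  apply: (lsim_step (@lsim_k13 T (U ++ nseq i 2) 0)); first lists_eq.
  apply: (lsim_step (@lsim_drop0 T (U ++ nseq i.+1 2) [:: 2; 1; 3])); first lists_eq.
  by apply: lsim_eq; lists_eq.
apply: (lsim_step (lsim_cat (nseq j 2 ++ [:: 3]) (@lsim_k12 T (U ++ nseq i 2) 0))); first lists_eq.
apply: (lsim_step (@lsim_drop0 T (U ++ nseq i.+1 2) (5 :: nseq j 2 ++ [:: 3]))); first lists_eq.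
case: j => [|j].
  by apply: (lsim_step (@lsim_53 T (U ++ nseq i.+1 2))); [|apply: lsim_eq]; lists_eq.
apply: (lsim_step (lsim_cat (nseq j 2 ++ [:: 3]) (@lsim_k2 T (U ++ nseq i.+1 2) 1))); first lists_eq.
have HP : chain_start (U ++ nseq i.+2 2 ++ [:: 1]) by rewrite /chain_start !last_cat orbT.
by apply: (lsim_step (@lsim_4_2s3 T _ j [::] HP)); [|apply: lsim_eq]; lists_eq.
Qed.

Lemma lsim_44 U r : lsim (U ++ 4 :: 4 :: r) (U ++ [:: 2; 2; 2; 2] ++ r).
Proof.
apply: (lsim_step (lsim_cat r (@lsim_4k T U 0))); first lists_eq.
by apply: (lsim_step (@lsim_drop0 T (U ++ [:: 2; 2; 2]) (2 :: r))); [|apply: lsim_eq]; lists_eq.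
Qed.

(** If a 2-block precedes the 1-block, [[2, 1, 4]] is merged into [[5, 2]]; the other 4-block moves
    up to the 5-block, and the rule for [[4, 5]] brings the 1-block back. *)
Lemma lsim_4_1_4 U i r : lsim (U ++ 4 :: nseq i 2 ++ 1 :: 4 :: r) (U ++ nseq i.+2 2 ++ 1 :: 2 :: 2 :: r).
Proof.
case: i => [|i].
  by apply: (lsim_step (lsim_cat r (@lsim_414 T U))); [|apply: lsim_eq]; lists_eq.
apply: (lsim_step (lsim_cat r (@lsim_k2V (U ++ 4 :: nseq i 2) 1))); first lists_eq.
apply: (lsim_step (@lsim_42s T U i (5 :: 2 :: r))); first lists_eq.
by apply: (lsim_step (lsim_cat (2 :: r) (@lsim_4k T (U ++ nseq i 2) 1))); [|apply: lsim_eq]; lists_eq.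
Qed.

End Lists.

(** * Lists of the required types *)

Ltac solve_notin_nseq := by rewrite ?inE ?mem_cat ?mem_nseq ?inE //= ?mem_nseq /= ?andbF ?orbF.

Lemma all2s_nseq n : all2s (nseq n 2).
Proof. by apply/allP=> x /nseqP [->]. Qed.

Lemma count_nseq_big n : count (fun x => 1 < x) (nseq n 2) = n.
Proof. by rewrite count_nseq mul1n. Qed.

Definition big_count s := count (fun x => 1 < x) s.

Lemma type234_ones n s : type234 s -> type234 (nseq n 1 ++ s).
Proof.
by elim: n.
Qed.

Lemma type234_cat1 s : type234 s -> type234 (s ++ [:: 1]).
Proof.
rewrite /type234 /type2 /type3 /type4 /many_big count_cat /= addn0.
rewrite chains_cat1 /= !all_cat !has_cat !count_cat /= !andbT !orbF !addn0.
by [].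
Qed.

Lemma type2_in s : 1 < big_count s -> all (fun x => (x == 1) || (x == 2)) s -> type234 s.
Proof. by move=> Hb Ha; rewrite /type234 /type2 /many_big Hb all_chains Ha. Qed.

Lemma type234_11 a b : 1 < a + b -> type234 (nseq a 2 ++ 1 :: nseq b 2).
Proof.
move=> H; apply: type2_in; first by rewrite /big_count count_cat /= !count_nseq_big.
by rewrite all_cat /= !all_nseq /= !orbT.
Qed.

Lemma type234_2 n : 1 < n -> type234 (nseq n 2).
Proof.
move=> H; apply: type2_in; first by rewrite /big_count count_nseq_big.
by rewrite all_nseq orbT.
Qed.

Lemma type4_cat cs c ds s : 1 < big_count s -> chains s = cs ++ c :: ds -> form4 c ->
  all all2s cs -> all all2s ds -> type234 s.
Proof.
have H e : all all2s e -> count form4 e = 0 /\ all (fun c => nonempty c ==> (form4 c || all2s c)) e.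
  elim: e => //= x e IH /andP [Hx /IH [-> ->]]; rewrite Hx orbT implybT addn0; split=> //.
  by case: x Hx => //= y x /andP [/eqP->].
move=> Hb Hs Hc /H [C1 A1] /H [C2 A2]; rewrite /type234 /type4 /many_big Hb Hs.
by rewrite count_cat all_cat /= C1 C2 A1 A2 Hc implybT !orbT.
Qed.

Lemma type234_4 n : 0 < n -> type234 (4 :: nseq n 2).
Proof.
move=> H; apply: (@type4_cat [::] (4 :: nseq n 2) [::]); rewrite ?all2s_nseq //.
- by rewrite /big_count /= count_nseq_big; lia.
- by rewrite chains_no1 //; solve_notin_nseq.
by rewrite /= all2s_nseq.
Qed.

Lemma type234_1_4 a b : 0 < a -> type234 (nseq a 2 ++ 1 :: 4 :: nseq b 2).
Proof.
move=> H; apply: (@type4_cat [:: nseq a 2] (4 :: nseq b 2) [::]); rewrite ?all2s_nseq //.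
- by rewrite /big_count count_cat /= !count_nseq_big; lia.
- by rewrite chains_cat1 !chains_no1 //; solve_notin_nseq.
- by rewrite /= all2s_nseq.
by rewrite /= all2s_nseq.
Qed.

Lemma type234_4_1 a b : 0 < a + b -> type234 (4 :: nseq a 2 ++ 1 :: nseq b 2).
Proof.
move=> H; apply: (@type4_cat [::] (4 :: nseq a 2) [:: nseq b 2]); rewrite ?all2s_nseq //.
- by rewrite /big_count /= count_cat /= !count_nseq_big; lia.
- by rewrite (chains_cat1 (4 :: nseq a 2)) !chains_no1 //; solve_notin_nseq.
- by rewrite /= all2s_nseq.
by rewrite /= all2s_nseq.
Qed.

Definition form3 c := nonempty c ==> (form3i c || form3ii c).

Lemma form3i_nseq a b : form3i (nseq a 2 ++ 3 :: nseq b 2).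
Proof. by rewrite /form3i count_cat all_cat /= !count_nseq !all_nseq /= !orbT. Qed.

Lemma all2s_form3 c : all2s c -> form3 c.
Proof. by rewrite /form3 /form3ii => ->; case: nonempty => //=; rewrite orbT. Qed.

Lemma type3_cat cs c ds s : 1 < big_count s -> chains s = cs ++ c :: ds -> form3i c ->
  all form3 cs -> all form3 ds -> type234 s.
Proof.
move=> Hb Hs Hc H1 H2; rewrite /type234 /type3 /many_big Hb Hs.
rewrite -[fun c : seq nat => _ ==> (form3i c || form3ii c)]/form3.
by rewrite all_cat has_cat /= H1 H2 /form3 Hc implybT !orbT.
Qed.

Lemma type234_3 a b : 0 < a + b -> type234 (nseq a 2 ++ 3 :: nseq b 2).
Proof.
move=> H; apply: (@type3_cat [::] (nseq a 2 ++ 3 :: nseq b 2) [::]) => //.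
- by rewrite /big_count count_cat /= !count_nseq_big; lia.
- by rewrite !chains_no1 //; solve_notin_nseq.
exact: form3i_nseq.
Qed.

Section Lists.
Variable T : Type.
Notation lsim := (lsim T).
Implicit Types (U P r s : seq nat).

(* The rules [4, k+4 -> 2, 2, 2, k, 2] and [2, k+4 -> 4, k, 2] lower a long block by
   4 at a time, leaving only 2-blocks and at most one 4-block on either side. *)
Lemma lsim_reduce n U a b (c4 w4 : bool) : chain_start U -> [|| 1 < n, 0 < a + b | w4] ->
  exists t, [/\ type234 t, 0 \notin t & lsim
    (U ++ nseq a 2 ++ (if c4 then 4 else 2) :: n :: (if w4 then [:: 4] else [::]) ++ nseq b 2)
    (U ++ t)].
Proof.
move=> HU; elim/ltn_ind: n a b c4 w4 => n IH a b c4 w4 Hn.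
case: (leqP 4 n) => Hn4.
  case: n Hn4 IH Hn => [|[|[|[|n]]]] // _ IH _.
  pose w := (if w4 then [:: 4] else [::]) ++ nseq b 2.
  have Hw V : lsim (V ++ 2 :: w) (V ++ (if w4 then [:: 4] else [::]) ++ nseq b.+1 2).
    rewrite /w; case: w4 {IH w} => /=; [exact: lsim_24|exact: lsim_refl].
  (* [c4] tells whether the left neighbour of the long block is a 4-block instead of a 2-block, [w4]
     whether a 4-block stands on its right. The rule for [[4, n+4]] clears [c4], the one for
     [[2, n+4]] sets it; the 2-block released on the right passes the 4-block by [Hw]. *)
  case: c4.
    have [||t [Ht H0 H]] := IH n _ a.+2 b.+1 false w4; [lia|by rewrite addSn /= orbT|].
    exists t; split=> //; apply: lsim_trans H.
    apply: (lsim_step (lsim_cat w (@lsim_4k T (U ++ nseq a 2) n))); first by rewrite /w; lists_eq.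
    apply: (lsim_step (Hw (U ++ nseq a.+2 2 ++ [:: 2; n]))); first by rewrite /w; lists_eq.
    by apply: lsim_eq; lists_eq.
  have [||t [Ht H0 H]] := IH n _ a b.+1 true w4; [lia|by rewrite addnS /= orbT|].
  exists t; split=> //; apply: lsim_trans H.
  apply: (lsim_step (lsim_cat w (@lsim_2k T (U ++ nseq a 2) n))); first by rewrite /w; lists_eq.
  apply: (lsim_step (Hw (U ++ nseq a 2 ++ [:: 4; n]))); first by rewrite /w; lists_eq.
  by apply: lsim_eq; lists_eq.
(* For sizes 0, 1 and 2 two 4-blocks on either side dissolve each other; a 3-block dissolves those
   on both of its sides. *)
case: n Hn4 IH Hn => [|[|[|[|n]]]] // _ _ Hn.
- case: c4 w4 Hn => [] [] Hn.
  + exists (nseq (a + b).+4 2); split; [by apply: type234_2|by solve_notin_nseq|].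
    apply: (lsim_step (@lsim_drop0 T (U ++ nseq a 2 ++ [:: 4]) (4 :: nseq b 2))); first lists_eq.
    apply: (lsim_step (@lsim_44 T (U ++ nseq a 2) (nseq b 2))); first lists_eq.
    by apply: lsim_eq; lists_eq.
  + exists (4 :: nseq (a + b) 2); split; [by apply: type234_4; rewrite orbF in Hn|by solve_notin_nseq|].
    apply: (lsim_step (@lsim_drop0 T (U ++ nseq a 2 ++ [:: 4]) (nseq b 2))); first lists_eq.
    by apply: (lsim_step (@lsim_2s4 T U a (nseq b 2))); [|apply: lsim_eq]; lists_eq.
  + exists (4 :: nseq (a + b).+1 2); split; [by apply: type234_4|by solve_notin_nseq|].
    apply: (lsim_step (@lsim_drop0 T (U ++ nseq a.+1 2) (4 :: nseq b 2))); first lists_eq.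
    by apply: (lsim_step (@lsim_2s4 T U a.+1 (nseq b 2))); [|apply: lsim_eq]; lists_eq.
  + exists (nseq (a + b).+1 2); split; [by apply: type234_2; rewrite orbF in Hn|by solve_notin_nseq|].
    by apply: (lsim_step (@lsim_drop0 T (U ++ nseq a.+1 2) (nseq b 2))); [|apply: lsim_eq]; lists_eq.
- case: c4 w4 Hn => [] [] Hn.
  + exists (nseq a.+2 2 ++ 1 :: nseq b.+2 2); split; [by apply: type234_11; lia|by solve_notin_nseq|].
    by apply: (lsim_step (@lsim_4_1_4 T (U ++ nseq a 2) 0 (nseq b 2))); [|apply: lsim_eq]; lists_eq.
  + exists (4 :: nseq a 2 ++ 1 :: nseq b 2); split; [by apply: type234_4_1; rewrite orbF in Hn|by solve_notin_nseq|].
    by apply: (lsim_step (@lsim_2s4 T U a (1 :: nseq b 2))); [|apply: lsim_eq]; lists_eq.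
  + exists (nseq a.+1 2 ++ 1 :: 4 :: nseq b 2); split; [by apply: type234_1_4|by solve_notin_nseq|].
    by apply: lsim_eq; lists_eq.
  + exists (nseq a.+1 2 ++ 1 :: nseq b 2); split; [by apply: type234_11; rewrite orbF /= in Hn; lia|by solve_notin_nseq|].
    by apply: lsim_eq; lists_eq.
- case: c4 w4 {Hn} => [] [].
  + exists (nseq (a + b).+4.+1 2); split; [by apply: type234_2|by solve_notin_nseq|].
    apply: (lsim_step (@lsim_42 T (U ++ nseq a 2) (4 :: nseq b 2))); first lists_eq.
    apply: (lsim_step (@lsim_44 T (U ++ nseq a.+1 2) (nseq b 2))); first lists_eq.
    by apply: lsim_eq; lists_eq.
  + exists (4 :: nseq (a + b).+1 2); split; [by apply: type234_4|by solve_notin_nseq|].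
    by apply: (lsim_step (@lsim_2s4 T U a (nseq b.+1 2))); [|apply: lsim_eq]; lists_eq.
  + exists (4 :: nseq (a + b).+2 2); split; [by apply: type234_4|by solve_notin_nseq|].
    by apply: (lsim_step (@lsim_2s4 T U a.+2 (nseq b 2))); [|apply: lsim_eq]; lists_eq.
  + exists (nseq (a + b).+2 2); split; [by apply: type234_2|by solve_notin_nseq|].
    by apply: lsim_eq; lists_eq.
- have H34 a' : lsim (U ++ nseq a'.+1 2 ++ 3 :: (if w4 then [:: 4] else [::]) ++ nseq b 2)
    (U ++ nseq a'.+1 2 ++ 3 :: nseq (if w4 then b.+2 else b) 2).
    by case: w4 {Hn} => /=; [exact: lsim_34|exact: lsim_refl].
  exists (nseq (if c4 then a.+2 else a.+1) 2 ++ 3 :: nseq (if w4 then b.+2 else b) 2).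
  split; [by apply: type234_3; case: c4|by case: c4; solve_notin_nseq|].
  case: c4; last by apply: (lsim_step (H34 a)); [|apply: lsim_eq]; lists_eq.
  apply: (lsim_step (@lsim_2s4 T U a (3 :: (if w4 then [:: 4] else [::]) ++ nseq b 2))); first lists_eq.
  apply: (lsim_step (@lsim_4_2s3 T U a ((if w4 then [:: 4] else [::]) ++ nseq b 2) HU)); first lists_eq.
  by apply: (lsim_step (H34 a.+1)); [|apply: lsim_eq]; lists_eq.
Qed.

End Lists.

(** * The five types together, and rearranging chains *)

Definition typed s := [|| type1 s, type2 s, type3 s, type4 s | type5 s].

Lemma type234_typed s : type234 s -> typed s.
Proof. by rewrite /typed /type234 => /or3P [] ->; rewrite ?orbT. Qed.

Lemma typed_ones n s : typed s -> typed (nseq n 1 ++ s).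
Proof. by elim: n. Qed.

Lemma typed_cat1 s : typed s -> typed (s ++ [:: 1]).
Proof.
rewrite /typed /type1 /type2 /type3 /type4 /type5 /many_big count_cat /= addn0.
rewrite chains_cat1 /= !all_cat !has_cat !count_cat /= !andbT !orbF !addn0.
by [].
Qed.

Lemma last_chainP s : exists P D, [/\ s = P ++ D, chain_start P & 1 \notin D].
Proof.
elim: s => [|x s [P [D [-> HP HD]]]]; first by exists [::], [::].
case: (eqVneq P [::]) HP => [->|HP0] HP.
  case: (eqVneq x 1) => [->|Hx]; first by exists [:: 1], D.
  by exists [::], (x :: D); rewrite inE negb_or eq_sym Hx.
exists (x :: P), D; split=> //; by case: P HP0 HP.
Qed.

Lemma chain_split c s : c \in chains s -> exists A B,
  [/\ s = A ++ c ++ B, chain_start A, 1 \notin c & B = [::] \/ exists B', B = 1 :: B'].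
Proof.
have [n] := ubnP (size s); elim: n s => // n IH s /ltnSE Hn.
case: (boolP (1 \in s)) => [|Hs]; last first.
  rewrite chains_no1 // inE => /eqP ->.
  by exists [::], [::]; rewrite cats0; split=> //; left.
move=> H1; case/splitPr: s / H1 Hn => s1 s2.
rewrite chains_cat1 mem_cat size_cat /= => Hn; case/orP=> /IH [|A [B [-> HA Hc HB]]]; try lia.
  exists A, (B ++ 1 :: s2); rewrite -!catA; split=> //; right.
  by case: HB => [->|[B' ->]]; eexists.
exists (s1 ++ 1 :: A), B; rewrite -!catA; split=> //.
by rewrite /chain_start last_cat /=; case/orP: HA => [/eqP->|]; [|case: (A) => //= a A' ->]; rewrite orbT.
Qed.

Section Lists.
Variable T : Type.
Notation lsim := (lsim T).
Implicit Types (U P r s c D : seq nat).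

(** A chain that is not the last one is closed by a 1-block, so [lsim_swap] can make it next to
    last. The last chain stays where it is, and it is there that new blocks are appended. The
    conditions defining the types depend on the chains only up to permutation, hence the [perm_eq]
    clauses. *)
Lemma chain_bring c s : c \in chains s ->
  (exists P, [/\ s = P ++ c, chain_start P & 1 \notin c]) \/
  exists U D, [/\ chain_start U, 1 \notin c, 1 \notin D,
    perm_eq (chains s) (chains (U ++ c ++ 1 :: D)) &
    perm_eq s (U ++ c ++ 1 :: D) /\ forall r, lsim (s ++ r) (U ++ c ++ 1 :: D ++ r)].
Proof.
case/chain_split=> A [B [-> HA Hc [->|[B' ->]]]].
  by left; exists A; rewrite cats0.
right; have [P [D [-> HP HD]]] := last_chainP B'.
have [csA HcA] := chains_start HA.
case/orP: HP => [/eqP->|].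
  exists A, D; rewrite !cat0s; split=> //; split=> // r.
  by apply: lsim_eq; rewrite -!catA.
case/lastP: P => [//|P x]; rewrite last_rcons => /eqP->.
have HU : chain_start (P ++ 1 :: A).
  rewrite /chain_start last_cat /=; case/orP: HA => [/eqP->|]; first by rewrite orbT.
  by case: (A) => //= a A' ->; rewrite orbT.
exists (P ++ 1 :: A), D; split=> //.
  rewrite cat_rcons -catA /= !(chains_cat1, HcA) (chains_no1 Hc).
  by apply/permP=> a; do ![rewrite count_cat /=]; lia.
split.
  apply/permP=> a; rewrite cat_rcons.
  by do ![rewrite count_cat /=]; lia.
move=> r; apply: (lsim_step (@lsim_swap T (A ++ c) P (D ++ r))); first by rewrite cat_rcons; lists_eq.
by apply: lsim_eq; lists_eq.
Qed.

End Lists.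

Lemma all2sP c : all2s c -> c = nseq (size c) 2.
Proof. by move/all_pred1P. Qed.

Lemma form3iP c : form3i c -> exists m l, c = nseq m 2 ++ 3 :: nseq l 2.
Proof.
elim: c => // x c IH; rewrite /form3i /= => /andP [Hn /andP [Hx Hc]].
case/orP: Hx Hn => /eqP -> /= Hn.
  by case: IH => [|m [l ->]]; [rewrite /form3i Hc andbT|exists m.+1, l].
exists 0, (size c) => /=; congr cons; apply: all2sP.
move: Hn; rewrite add1n eqSS -leqn0 leqNgt -has_count -all_predC => H3.
apply/allP=> x' Hx'; move/allP: Hc => /(_ x' Hx'); move/allP: H3 => /(_ x' Hx') /=.
by case: (x' == 3); rewrite ?orbF.
Qed.

Lemma form4P c : form4 c -> exists m, c = 4 :: nseq m 2.
Proof. by case: c => //= x c /andP [/eqP-> /all2sP ->]; eexists. Qed.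

Lemma form3_rcons2 D : form3 D -> form3 (D ++ [:: 2]) && (form3i (D ++ [:: 2]) == form3i D).
Proof.
rewrite /form3 /form3i /form3ii /nonempty /all2s size_cat addn1 /= !all_cat /= !andbT.
rewrite count_cat /= !addn0 eqxx andbT.
by case: D => //= x D; case/orP=> ->; rewrite ?orbT.
Qed.

Lemma big_count_cat s t : big_count (s ++ t) = big_count s + big_count t.
Proof. exact: count_cat. Qed.

Lemma big_count_nseq n : big_count (nseq n 2) = n.
Proof. exact: count_nseq_big. Qed.

Lemma big_count_cons x s : big_count (x :: s) = (1 < x) + big_count s.
Proof. by []. Qed.

Definition big_countE := (big_count_cat, big_count_cons, big_count_nseq).

Lemma big_count_perm s t : perm_eq s t -> big_count s = big_count t.
Proof. by move/permP; apply. Qed.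

Variant type234_spec s : bool -> Prop :=
| Type2 of 1 < big_count s & all (fun x => (x == 1) || (x == 2)) s : type234_spec s true
| Type3 of 1 < big_count s & all form3 (chains s) & has form3i (chains s) : type234_spec s true
| Type4 of 1 < big_count s & count form4 (chains s) = 1
   & all (fun c => form4 c || all2s c) (chains s) : type234_spec s true.

Lemma type234P s : type234 s -> type234_spec s true.
Proof.
case/or3P.
- by rewrite /type2 all_chains => /andP [Hb Ha]; apply: Type2.
- by case/and3P=> Hb Ha Hh; apply: Type3.
case/and3P=> Hb /eqP Hc Ha; apply: Type4 => //.
by apply: sub_all Ha => c; case: c => //.
Qed.

Lemma type4_in s : 1 < big_count s -> count form4 (chains s) = 1 ->
  all (fun c => form4 c || all2s c) (chains s) -> type234 s.
Proof.
move=> Hb Hc Ha; rewrite /type234 /type4 /many_big Hb Hc eqxx.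
by rewrite (sub_all _ Ha) ?orbT // => c ->; rewrite implybT.
Qed.

Lemma type3_in s : 1 < big_count s -> all form3 (chains s) -> has form3i (chains s) -> type234 s.
Proof.
move=> Hb Ha Hh; rewrite /type234 /type3 /many_big Hb Hh.
by rewrite -[fun c : seq nat => _ ==> (form3i c || form3ii c)]/form3 Ha !orbT.
Qed.

Lemma type234_cat2 s : type234 s -> type234 (s ++ [:: 2]).
Proof.
have [P [D [-> HP HD]]] := last_chainP s; have [cs Hcs] := chains_start HP.
have HD2 : chains (D ++ [:: 2]) = [:: D ++ [:: 2]].
  by rewrite chains_no1 // mem_cat negb_or HD.
case/type234P.
- move=> Hb Ha; apply: type2_in; first by rewrite big_count_cat; lia.
  by rewrite all_cat Ha.
- move=> Hb; rewrite Hcs (chains_no1 HD) all_cat has_cat /= andbT orbF => /andP [A1 A2] Hh.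
  have /andP [B1 /eqP B2] := form3_rcons2 A2.
  apply: type3_in; rewrite -?catA ?big_count_cat ?Hcs ?HD2 ?all_cat ?has_cat /= ?A1 ?B1 //.
    by move: Hb; rewrite !big_count_cat; lia.
  by rewrite B2 orbF.
move=> Hb; rewrite Hcs (chains_no1 HD) count_cat all_cat /= andbT addn0 => Hc /andP [A1 A2].
have B : (form4 (D ++ [:: 2]) = form4 D) /\ (all2s (D ++ [:: 2]) = all2s D).
  rewrite /all2s all_cat andbT; split=> //; case: (D) => //= x E.
  by rewrite /all2s all_cat andbT.
apply: type4_in; rewrite -?catA ?Hcs ?HD2 ?count_cat ?all_cat /= ?B.1 ?B.2 ?addn0 ?A1 ?A2 //.
by move: Hb; rewrite !big_count_cat; lia.
Qed.

(** * Appending a 2-block or a 3-block to a list of a given type *)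

Section Lists.
Variable T : Type.
Notation lsim := (lsim T).
Implicit Types (U P r s c D : seq nat).

(** Zeros may occur on the way but not in the target, since the block bounds must increase
    strictly. *)
Definition good s := exists t, [/\ typed t, 0 \notin t & lsim s t].

Lemma good_lsim s s' : lsim s s' -> good s' -> good s.
Proof. by move=> H [t [H1 H2 H3]]; exists t; split=> //; apply: lsim_trans H H3. Qed.

Lemma good_typed s : typed s -> 0 \notin s -> good s.
Proof. by move=> H1 H2; exists s; split=> //; apply: lsim_refl. Qed.

Lemma good_234 s : type234 s -> 0 \notin s -> good s.
Proof. by move/type234_typed; apply: good_typed. Qed.

(** The new 3-block is the second one in its chain. If 2-blocks lie between the two, [lsim_3_2s3]
    applies. If they are adjacent, the 2-blocks before them decide: [[3, 3]] becomes [[2, 1, 3]],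
    [[2, 3, 3]] becomes [[5, 3]] and then [[2, 1, 2, 3]], and with more of them [lsim_2233]
    applies. *)
Lemma good_cat3_form3i P m l cs : chain_start P -> (forall r, chains (P ++ r) = cs ++ chains r) ->
  all form3 cs -> 0 \notin P -> good (P ++ nseq m 2 ++ 3 :: nseq l 2 ++ [:: 3]).
Proof.
move=> HP Hcs Ha H0.
have fin2 c1 n : 0 < size c1 -> 1 \notin c1 -> all2s c1 ->
   type234 (P ++ c1 ++ 1 :: nseq n 2 ++ [:: 3]).
  move=> Hb H1 H2; apply: (@type3_cat (cs ++ [:: c1]) (nseq n 2 ++ [:: 3]) [::]).
  - rewrite (all2sP H2) !big_countE; lia.
  - by rewrite Hcs chains_cat1 !chains_no1 -?catA //; solve_notin_nseq.
  - exact: (form3i_nseq n 0).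
  - by rewrite all_cat Ha /= all2s_form3.
  - by [].
have fin1 c1 n : 1 \notin c1 -> all2s c1 -> 0 < size c1 ->
   type234 (c1 ++ 1 :: P ++ nseq n 2 ++ [:: 3]).
  move=> H1 H2 Hs; apply: (@type3_cat (c1 :: cs) (nseq n 2 ++ [:: 3]) [::]).
  - rewrite (all2sP H2) !big_countE; lia.
  - by rewrite chains_cat1 Hcs !chains_no1 //; solve_notin_nseq.
  - exact: (form3i_nseq n 0).
  - by rewrite /= Ha /= all2s_form3.
  - by [].
have no0 c1 n : 0 \notin c1 -> 0 \notin c1 ++ 1 :: P ++ nseq n 2 ++ [:: 3].
  by move=> H; rewrite mem_cat (negPf H) inE /= mem_cat (negPf H0) mem_cat mem_nseq andbF.
case: l => [|l].
  case: m => [|[|m]] /=.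
  - apply: (good_lsim (@lsim_k3 T P 1 [::] HP)); apply: good_234; first exact: (fin2 [:: 2] 0).
    by rewrite mem_cat (negPf H0).
  - apply: (good_lsim (@lsim_2k3 T P 3 [::] HP)); apply: (good_lsim (@lsim_53 T P)).
    apply: good_234; first exact: (fin2 [:: 2] 1).
    by rewrite mem_cat (negPf H0).
  - have HP' : chain_start ([:: 2; 1] ++ P).
      by case/orP: HP => [/eqP->|] //; rewrite /chain_start /=; case: (P) => //= a P' ->.
    apply: good_lsim (good_234 (fin1 [:: 2] m.+2 isT isT isT) (no0 [:: 2] m.+2 isT)).
    apply: (lsim_step (@lsim_2233 T (P ++ nseq m 2))); first lists_eq.
    apply: (lsim_step (@lsim_2s4 T ([:: 2; 1] ++ P) m [:: 3])); first lists_eq.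
    by apply: (lsim_step (@lsim_4_2s3 T ([:: 2; 1] ++ P) m [::] HP')); [|apply: lsim_eq]; lists_eq.
apply: (@good_lsim _ ((if odd l then 4 :: nseq l 2 else nseq l.+2 2) ++ 1 :: P ++ nseq m 2 ++ [:: 3])).
  by apply: (lsim_step (@lsim_3_2s3 T (P ++ nseq m 2) l [::])); [|apply: lsim_eq]; lists_eq.
case: (odd l); last first.
  have H1 : 1 \notin nseq l.+2 2 by solve_notin_nseq.
  have H2 : 0 \notin nseq l.+2 2 by solve_notin_nseq.
  exact: good_234 (fin1 _ m H1 (all2s_nseq _) isT) (no0 _ m H2).
have H1 : 1 \notin nseq l.+2 2 by solve_notin_nseq.
have H2 : 0 \notin nseq l.+2 2 by solve_notin_nseq.
(* For odd [l] the new first chain starts with a 4-block. Unless it is already next to last,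
   [lsim_swap] puts it there, and the 3-block of the last chain dissolves the 4-block. *)
case/orP: HP => [/eqP EP|].
  move: (good_234 (fin1 _ m H1 (all2s_nseq _) isT) (no0 _ m H2)); rewrite {}EP.
  exact: good_lsim (@lsim_4_1_3 T [::] l m).
case/lastP: P Hcs H0 fin1 fin2 no0 => [//|P x] Hcs H0 _ fin2 _; rewrite last_rcons => /eqP Ex; subst x.
have G := good_234 (fin2 (nseq l.+2 2) m isT H1 (all2s_nseq _)).
apply: (good_lsim _ (G _)); last first.
  by rewrite mem_cat (negPf H0) mem_cat (negPf H2) inE /= mem_cat mem_nseq andbF.
apply: (lsim_step (@lsim_swap T (4 :: nseq l 2) P (nseq m 2 ++ [:: 3]))); first by rewrite cat_rcons; lists_eq.
apply: (lsim_step (@lsim_4_1_3 T (P ++ [:: 1]) l m)); first lists_eq.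
by apply: lsim_eq; rewrite cat_rcons; lists_eq.
Qed.

(** If the last chain has only 2-blocks and no chain holds a 4-block, the result is of Type 3. A
    3-block in the last chain is the case of [good_cat3_form3i]. In Type 4 the chain of the 4-block
    is made last or next to last, where the new 3-block dissolves the 4-block. *)
Lemma good_cat3_234 s : type234 s -> 0 \notin s -> good (s ++ [:: 3]).
Proof.
move=> Hs H0; have [P [D [E HP HD]]] := last_chainP s; have [cs Hcs] := chains_start HP.
have H3 : 0 \notin s ++ [:: 3] by rewrite mem_cat (negPf H0).
have fin D' : all form3 cs -> D = D' -> all2s D' -> 1 < big_count (s ++ [:: 3]) -> good (s ++ [:: 3]).
  move=> Ha E1 HD' Hb; apply: good_234 => //.
  apply: (@type3_cat cs (D ++ [:: 3]) [::]) => //.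
    by rewrite E -catA Hcs chains_no1 // mem_cat negb_or HD.
  by rewrite E1 (all2sP HD'); apply: (form3i_nseq _ 0).
have Hb3 : 1 < big_count s -> 1 < big_count (s ++ [:: 3]) by rewrite big_count_cat; lia.
case/type234P: Hs (Hs) => Hb.
- move=> Ha _.
  have : all all2s (chains s) by rewrite all_chains.
  rewrite {1}E Hcs (chains_no1 HD) all_cat /= andbT => /andP [H1 H2].
  by apply: (fin D) => //; [exact: sub_all all2s_form3 _ H1|exact: Hb3].
- rewrite {1}E Hcs (chains_no1 HD) all_cat /= andbT => /andP [Ha H2] _ _.
  move: H2; rewrite /form3; case: (eqVneq D [::]) => [D0 _|D0].
    by apply: (fin [::]) => //; exact: Hb3.
  have -> /= : nonempty D by rewrite /nonempty; case: (D) D0.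
  case/orP=> [/form3iP [m [l ED]]|/andP [_ H2]]; last by apply: (fin D) => //; exact: Hb3.
  rewrite E ED -!catA /=; apply: good_cat3_form3i Hcs Ha _ => //.
  by move: H0; rewrite E mem_cat negb_or => /andP [].
move=> Hc Ha _.
have /hasP [c Hcc H4] : has form4 (chains s) by rewrite has_count Hc.
have [i Ec] := form4P H4; subst c.
have rest e : perm_eq (chains s) ((4 :: nseq i 2) :: e) -> all all2s e.
  move=> Hp; have F e' : all (fun c => form4 c || all2s c) e' -> count form4 e' = 0 -> all all2s e'.
    elim: e' => //= x e' IH /andP [/orP [->|->] //=] A /eqP.
    by rewrite addn_eq0 => /andP [_ /eqP]; apply: IH.
  move: (Hc) (Ha); rewrite (permP Hp) (perm_all _ Hp) /= all2s_nseq add1n => -[C0] A.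
  exact: F.
have no3 c : all2s c -> all form3 [:: c] by move/all2s_form3; rewrite /= andbT.
have [[P' [E' HP' H1]]|[U [D' [HU H1 HD' Hp [Hps Hl]]]]] := @chain_bring T _ _ Hcc.
  have [cs' Hcs'] := chains_start HP'.
  have A : all all2s cs' by apply: rest; rewrite E' Hcs' chains_no1 // perm_catC.
  apply: (@good_lsim _ (P' ++ nseq i.+2 2 ++ [:: 3])).
    by apply: (lsim_step (@lsim_4_2s3 T P' i [::] HP')); [|apply: lsim_eq]; rewrite ?E'; lists_eq.
  apply: good_234; last by rewrite mem_cat mem_cat mem_nseq andbF orbF; move: H0; rewrite E' mem_cat negb_or => /andP [/negPf ->].
  apply: (@type3_cat cs' (nseq i.+2 2 ++ [:: 3]) [::]) => //.
  - by rewrite !big_countE; clear; lia.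
  - by rewrite Hcs' chains_no1 //; solve_notin_nseq.
  - exact: (form3i_nseq _ 0).
  - exact: sub_all all2s_form3 _ A.
have [cs' Hcs'] := chains_start HU.
have /andP [A2 A1] : all all2s (D' :: cs').
  apply: rest; rewrite (perm_trans Hp) // Hcs' chains_cat1 !chains_no1 //.
  by rewrite perm_catC.
apply: (good_lsim (Hl [:: 3])); rewrite (all2sP A2).
apply: (good_lsim (@lsim_4_1_3 T U i (size D'))).
apply: good_234; last first.
  have /negPf U0 : 0 \notin U by apply: contra H0 => HU0; rewrite (perm_mem Hps) mem_cat HU0.
  by rewrite !(mem_cat, mem_nseq, inE) U0 !andbF.
apply: (@type3_cat (cs' ++ [:: nseq i.+2 2]) (nseq (size D') 2 ++ [:: 3]) [::]) => //.
- by rewrite !big_countE; clear; lia.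
- by rewrite Hcs' chains_cat1 !chains_no1 -?catA //; solve_notin_nseq.
- exact: (form3i_nseq _ 0).
- by rewrite all_cat no3 ?andbT ?all2s_nseq //; apply: sub_all all2s_form3 _ A1.
Qed.

End Lists.

Lemma type1P s : type1 s -> 0 \notin s ->
  s = nseq (size s) 1 \/ exists p k q, s = nseq p 1 ++ k.+2 :: nseq q 1.
Proof.
elim: s => [|x s IH]; first by left.
rewrite inE negb_or => H1 /andP [Hx H0].
case: (eqVneq x 1) H1 => [->|Hx1] H1.
  case: (IH H1 H0) => [->|[p [k [q ->]]]]; first by left; rewrite /= size_nseq.
  by right; exists p.+1, k, q.
right; exists 0, x.-2, (size s); move: H1; rewrite /type1 /= (negPf Hx1) /=.
rewrite [size (head _ _) < 1]ltnS leqn0 => /andP [Hc /andP [Hh Hb]].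
have Hall : all (fun c : seq nat => size c == 0) (chains s).
  rewrite chains_neq0 /= Hh /=; move: Hc; rewrite add1n ltnS leqn0 -leqn0 leqNgt -has_count.
  by rewrite -all_predC; apply: sub_all => c; rewrite /= /nonempty negbK.
have -> : x.-2.+2 = x by case: x Hx Hx1 {Hc} => [|[|x]].
congr cons; apply/all_pred1P; have := all_chains pred0 s; rewrite (eq_all (a2 := fun c => size c == 0)).
  by rewrite Hall => /esym; apply: sub_all => y; rewrite orbF.
by case.
Qed.

Section Lists.
Variable T : Type.
Notation lsim := (lsim T).
Notation good := (good T).
Implicit Types (U P r s c D : seq nat).

Let notin0_ones n t : 0 \notin t -> 0 \notin nseq n 1 ++ t.
Proof. by move=> H; rewrite mem_cat (negPf H) mem_nseq andbF. Qed.

Let chain_start_ones n : chain_start (nseq n 1).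
Proof. by case: n => [|n] //; rewrite /chain_start -[n.+1]addn1 nseqD last_cat orbT. Qed.

Let good_ones p t : typed t -> 0 \notin t -> good (nseq p 1 ++ t).
Proof. by move=> Ht H; apply: good_typed; [apply: typed_ones|apply: notin0_ones]. Qed.

(** By [lsim_swap], all but one of the 1-blocks behind the long block go to the front; only the
    presence of a separating 1-block matters. *)
Lemma lsim_rotate_ones p k q x :
  lsim (nseq p 1 ++ k :: nseq q.+1 1 ++ [:: x]) (nseq (p + q) 1 ++ [:: k; 1; x]).
Proof.
case: q => [|q]; first by rewrite addn0; apply: lsim_refl.
have S1 m r : nseq m 1 ++ 1 :: r = nseq m.+1 1 ++ r by elim: m => //= m ->.
apply: (lsim_step (@lsim_swap T (nseq p 1 ++ [:: k]) (nseq q 1) [:: x])).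
  by rewrite S1 -catA.
by apply: lsim_eq; rewrite S1 -catA catA -nseqD addnC.
Qed.

(** A long block of size at least 6 is replaced by one that is smaller by 4, standing between a
    2-block and a 4- or 5-block; in general [lsim_reduce] then finishes. Smaller sizes already have
    a type, except for [[5, 2]], which needs one rule. *)
Lemma good_cat2_type1 s : type1 s -> 0 \notin s -> good (s ++ [:: 2]).
Proof.
move=> H1 H0; case: (type1P H1 H0) => [->|[p [k [q E]]]]; first exact: good_ones.
subst s => {H1 H0}; case: q => [|q]; rewrite -catA /=.
  case: k => [|[|[|[|k]]]]; try exact: good_ones.
    by apply: (good_lsim (@lsim_k2 T (nseq p 1) 1)); apply: good_ones.
  apply: (good_lsim (@lsim_k2 T (nseq p 1) k.+2)).
  have [|t [Ht Ht0 H]] := @lsim_reduce T k.+2 (nseq p 1) 0 0 false true (chain_start_ones p) => //.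
  by apply: (good_lsim H); apply: good_234; [exact: type234_ones|exact: notin0_ones].
apply: (good_lsim (@lsim_rotate_ones p k.+2 q 2)).
case: k => [|[|[|[|k]]]]; try exact: good_ones.
move: (p + q) => {}p; apply: (good_lsim (@lsim_k12 T (nseq p 1) k.+2)).
(* The list now ends in [[2, k+2, 5]]. The 5-block is broken by its left neighbour through [[2, 5]]
   or [[3, 5]]; a longer neighbour is first lowered by 4, which puts a 2-block next to the
   5-block. *)
case: k => [|[|k]].
- apply: (@good_lsim T _ (nseq p 1 ++ [:: 2; 4; 1; 2])).
    by apply: (lsim_step (@lsim_2k T (nseq p 1 ++ [:: 2]) 1)); [|apply: lsim_eq]; lists_eq.
  by apply: (good_lsim (@lsim_24 T (nseq p 1) [:: 1; 2])); apply: good_ones.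
- apply: (@good_lsim T _ (nseq p 1 ++ [:: 2; 3; 2; 1; 2])).
    by apply: (lsim_step (@lsim_35 T (nseq p 1 ++ [:: 2]))); [|apply: lsim_eq]; lists_eq.
  exact: good_ones.
have [|t [Ht Ht0 H]] := @lsim_reduce T k (nseq p 1) 0 0 true true (chain_start_ones _); first by rewrite /= ?orbT.
apply: (@good_lsim T _ (nseq p 1 ++ t ++ [:: 1; 2])).
  apply: (lsim_step (lsim_cat [:: 5] (@lsim_2k T (nseq p 1) k))); first lists_eq.
  apply: (lsim_step (@lsim_2k T (nseq p 1 ++ [:: 4; k]) 1)); first lists_eq.
  by apply: (lsim_step (lsim_cat [:: 1; 2] H)); [|apply: lsim_eq]; lists_eq.
apply: good_234; last by apply: notin0_ones; rewrite mem_cat (negPf Ht0).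
apply: type234_ones; rewrite -[[:: 1; 2]]/([:: 1] ++ [:: 2]) catA.
by apply: type234_cat2; apply: type234_cat1.
Qed.

Lemma good_cat3_type1 s : type1 s -> 0 \notin s -> good (s ++ [:: 3]).
Proof.
move=> H1 H0; case: (type1P H1 H0) => [->|[p [k [q E]]]]; first exact: good_ones.
subst s => {H1 H0}; case: q => [|q]; rewrite -catA /=.
  case: k => [|k]; first exact: good_ones.
  apply: (good_lsim (@lsim_k3 T (nseq p 1) k.+1 [::] (chain_start_ones p))).
  case: k => [|k]; first exact: good_ones.
  have [|t [Ht Ht0 H]] := @lsim_reduce T k.+2 (nseq p 1) 0 0 false false (chain_start_ones p) => //.
  apply: (@good_lsim T _ ((nseq p 1 ++ t) ++ [:: 3])).
    by apply: (lsim_step (lsim_cat [:: 3] H)); [|apply: lsim_eq]; lists_eq.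
  by apply: good_cat3_234; [apply: type234_ones|apply: notin0_ones].
apply: (good_lsim (@lsim_rotate_ones p k.+2 q 3)).
case: k => [|[|k]]; try exact: good_ones.
move: (p + q) => {}p; apply: (good_lsim (@lsim_k13 T (nseq p 1) k)).
have [|t [Ht Ht0 H]] := @lsim_reduce T k (nseq p 1) 0 1 false false (chain_start_ones _); first by rewrite /= ?orbT.
apply: (@good_lsim T _ ((nseq p 1 ++ t ++ [:: 1]) ++ [:: 3])).
  by apply: (lsim_step (lsim_cat [:: 1; 3] H)); [|apply: lsim_eq]; lists_eq.
apply: good_cat3_234; last by apply: notin0_ones; rewrite mem_cat (negPf Ht0).
by apply: type234_ones; apply: type234_cat1.
Qed.

Lemma type5_bring s : type5 s -> 0 \notin s ->
  (exists P cs, [/\ chain_start P, s = P ++ [:: 5], forall r, chains (P ++ r) = cs ++ chains r,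
     all all2s cs & 0 \notin P]) \/
  exists U cs D, [/\ D = [::] \/ D = [:: 2], forall r, chains (U ++ r) = cs ++ chains r,
    all (fun c => (c == [::]) || (c == [:: 2])) cs, 0 \notin U /\ 1 < big_count (U ++ 5 :: 1 :: D) &
    forall r, lsim (s ++ r) (U ++ 5 :: 1 :: D ++ r)].
Proof.
case/and3P=> Hb /eqP Hc Ha H0.
have /hasP [c Hcc /eqP Ec] : has (fun c => c == [:: 5]) (chains s) by rewrite has_count Hc.
have rest e : perm_eq (chains s) ([:: 5] :: e) -> all (fun c => (c == [::]) || (c == [:: 2])) e.
  move=> Hp; move: Hc Ha; rewrite (permP Hp) (perm_all _ Hp) /= add1n => -[] {Hp}.
  elim: e => //= x e IH /eqP; rewrite addn_eq0 => /andP [Hx /eqP He] /andP [Hs /(IH He) ->].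
  rewrite andbT; move: Hs Hx; case: (x =P [:: 5]) => //= _.
  by case: x => //= y x ->.
have [[P [E HP H1]]|[U [D [HU H1 HD Hp [Hps Hl]]]]] := @chain_bring T _ _ Hcc; subst c.
  left; have [cs Hcs] := chains_start HP; exists P, cs; split=> //.
    have := rest cs; rewrite E Hcs perm_catC => /(_ (perm_refl _)).
    by apply: sub_all => c /orP [] /eqP ->.
  by move: H0; rewrite E mem_cat negb_or => /andP [].
right; have [cs Hcs] := chains_start HU.
have /andP [A2 A1] : all (fun c => (c == [::]) || (c == [:: 2])) (D :: cs).
  apply: rest; rewrite (perm_trans Hp) // Hcs (chains_cat1 [:: 5]) (chains_no1 HD).
  by rewrite perm_catC.
exists U, cs, D; split=> //; first by case/orP: A2 => /eqP ->; [left|right].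
split; last by rewrite -(big_count_perm Hps).
by apply: contra H0 => HU0; rewrite (perm_mem Hps) mem_cat HU0.
Qed.

(** If the last chain is empty, Type 5 persists. Otherwise the 5-block is brought in front of a
    2-block of its own chain, if necessary by turning [[5, 1, 2]] into [[2, 1, 5]], and [[5, 2]]
    becomes [[2, 1, 4]]: Type 4. *)
Lemma good_cat2_type5 s : type5 s -> 0 \notin s -> good (s ++ [:: 2]).
Proof.
move=> H5 H0; have [[P [cs [HP -> Hcs Ha HP0]]]|[U [cs [D [HD Hcs Ha [U0 Hb] Hl]]]]] := type5_bring H5 H0.
  rewrite -catA; apply: (good_lsim (@lsim_k2 T P 1)); apply: good_234.
    apply: (@type4_cat (cs ++ [:: [:: 2]]) [:: 4] [::]) => //; last by rewrite all_cat Ha.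
      by rewrite !big_countE; clear; lia.
    by rewrite Hcs -catA.
  by rewrite mem_cat (negPf HP0).
apply: (good_lsim (Hl [:: 2])); case: HD => ED; subst D => /=.
  apply: good_typed; last by rewrite mem_cat (negPf U0).
  rewrite /typed /type5 /many_big -/(big_count _) Hcs count_cat all_cat /=.
  have -> : 1 < big_count (U ++ [:: 5; 1; 2]) by move: Hb; rewrite !big_countE; clear; lia.
  have -> : count (fun c => c == [:: 5]) cs = 0.
    apply/eqP; rewrite -leqn0 leqNgt -has_count -all_predC; apply: sub_all Ha => c.
    by case/orP => /eqP ->.
  rewrite (sub_all _ Ha) ?orbT // => c; by case/orP => /eqP ->.
apply: (@good_lsim T _ (U ++ [:: 2; 1; 2; 1; 4])).
  apply: (lsim_step (lsim_cat [:: 2] (@lsim_k12 T U 1))); first lists_eq.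
  by apply: (lsim_step (@lsim_k2 T (U ++ [:: 2; 1]) 1)); [|apply: lsim_eq]; lists_eq.
apply: good_234; last by rewrite mem_cat (negPf U0).
apply: (@type4_cat (cs ++ [:: [:: 2]; [:: 2]]) [:: 4] [::]) => //.
- by rewrite !big_countE; clear; lia.
- by rewrite Hcs -catA.
- by rewrite all_cat andbT; apply: sub_all Ha => c /orP [] /eqP ->.
Qed.

Lemma good_cat3_type5 s : type5 s -> 0 \notin s -> good (s ++ [:: 3]).
Proof.
move=> H5 H0; have [[P [cs [HP -> Hcs Ha HP0]]]|[U [cs [D [HD Hcs Ha [U0 Hb] Hl]]]]] := type5_bring H5 H0.
  rewrite -catA; apply: (good_lsim (@lsim_53 T P)); apply: good_234.
    apply: (@type3_cat (cs ++ [:: [:: 2]]) [:: 2; 3] [::]) => //.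
    - by rewrite !big_countE; clear; lia.
    - by rewrite Hcs -catA.
    - by rewrite all_cat andbT; apply: sub_all Ha; apply: all2s_form3.
  by rewrite mem_cat (negPf HP0).
have Ha3 : all form3 cs by apply: sub_all Ha => c /orP [] /eqP ->.
apply: (good_lsim (Hl [:: 3])); case: HD => ED; subst D => /=.
  apply: (good_lsim (@lsim_k13 T U 1)); apply: good_234; last by rewrite mem_cat (negPf U0).
  apply: (@type3_cat (cs ++ [:: [:: 2]; [:: 2]]) [:: 3] [::]) => //.
  - by rewrite !big_countE; clear; lia.
  - by rewrite Hcs -catA.
  - by rewrite all_cat Ha3.
apply: (@good_lsim T _ (U ++ [:: 2; 1; 2; 1; 2; 3])).
  apply: (lsim_step (lsim_cat [:: 3] (@lsim_k12 T U 1))); first lists_eq.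
  by apply: (lsim_step (@lsim_53 T (U ++ [:: 2; 1]))); [|apply: lsim_eq]; lists_eq.
apply: good_234; last by rewrite mem_cat (negPf U0).
apply: (@type3_cat (cs ++ [:: [:: 2]; [:: 2]]) [:: 2; 3] [::]) => //.
- by rewrite !big_countE; clear; lia.
- by rewrite Hcs -catA.
- by rewrite all_cat Ha3.
Qed.

Lemma good_cat2 s : typed s -> 0 \notin s -> good (s ++ [:: 2]).
Proof.
move=> Hs H0; have H2 : 0 \notin s ++ [:: 2] by rewrite mem_cat (negPf H0).
case: (boolP (type234 s)) => [H|]; first exact: good_234 (type234_cat2 H) H2.
rewrite /type234; case/or3P: Hs => [H _|->//|]; first exact: good_cat2_type1.
by case/or3P=> [->|->|H _]; rewrite ?orbT //; apply: good_cat2_type5.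
Qed.

Lemma good_cat3 s : typed s -> 0 \notin s -> good (s ++ [:: 3]).
Proof.
move=> Hs H0; case: (boolP (type234 s)) => [H|]; first exact: good_cat3_234.
rewrite /type234; case/or3P: Hs => [H _|->//|]; first exact: good_cat3_type1.
by case/or3P=> [->|->|H _]; rewrite ?orbT //; apply: good_cat3_type5.
Qed.

End Lists.

(** * Normalising arbitrary middle words *)

Section Subst.
Variable T : Type.
Implicit Types (t b u v w : seq T) (f g : T -> seq T).

(* [insert_before f w] glues the word [f x] in front of each letter [x]; an exchange
   carries a glued word along with its letter, whence [sim_insert]. *)
Fixpoint insert_before f w := if w is x :: w' then f x ++ x :: insert_before f w' else [::].

Lemma insert_before_cat f u v : insert_before f (u ++ v) = insert_before f u ++ insert_before f v.
Proof. by elim: u => //= x u ->; rewrite -catA. Qed.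

Lemma sim_insert f g t b t' b' : sim t b t' b' ->
  sim (insert_before f t) (insert_before g b) (insert_before f t') (insert_before g b').
Proof.
elim=> {t b t' b'}.
- by move=> t b; apply: sim_refl.
- by move=> t b t' b' _; apply: sim_sym.
- by move=> t b t' b' t'' b'' _ IH _; apply: sim_trans IH.
- move=> p x r y s p' r' s'; do ?[rewrite insert_before_cat /=].
  by apply: sim_cast (sim_swap2 (_ ++ f x) x (_ ++ f y) y _ (_ ++ g x) (_ ++ g y) _) _ _ _ _; rewrite -!catA.
- move=> p x q y r z s p' q' r' s'; do ?[rewrite insert_before_cat /=].
  by apply: sim_cast (sim_swap3 (_ ++ f x) x (_ ++ f y) y (_ ++ f z) z _ (_ ++ g y) (_ ++ g z) (_ ++ g x) _)
    _ _ _ _; rewrite -!catA.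
move=> p x q y r z s p' q' r' s'; do ?[rewrite insert_before_cat /=].
by apply: sim_cast (sim_swap3' (_ ++ g x) x (_ ++ g y) y (_ ++ g z) z _ (_ ++ f y) (_ ++ f z) (_ ++ f x) _)
  _ _ _ _; rewrite -!catA.
Qed.

(** All that is asked of the earlier part is a pair [p], [q] occurring in opposite orders in the two
    words. The first two letters of any block of size at least 2 provide one; 1-blocks alone do
    not. *)
Lemma sim_last_block A B C D E F Y Y' (p q g h i j : T) :
  exists t b, sim (A ++ p :: B ++ q :: C ++ g :: h :: Y ++ [:: i; j])
    (D ++ q :: E ++ p :: F ++ j :: i :: Y' ++ [:: h; g]) (t ++ [:: i; h]) (b ++ [:: h; i]).
Proof.
exists (A ++ p :: j :: C ++ g :: B ++ q :: Y), (D ++ q :: g :: F ++ j :: E ++ p :: Y').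
swap2 p i.
swap3' j q h.
swap2 i g.
rewrite -!catA; exact: sim_refl.
Qed.

Lemma insert_before_nil w : insert_before (fun _ => [::]) w = w.
Proof. by elim: w => //= x w ->. Qed.

End Subst.

Section Exists.
Variable T : eqType.
Implicit Types (t b u v w : seq T).

Lemma sim_perm t b t' b' : sim t b t' b' -> perm_eq t t' /\ perm_eq b b'.
Proof.
elim=> {t b t' b'}.
- by [].
- by move=> t b t' b' _ [H1 H2]; rewrite !(perm_sym t') !(perm_sym b').
- by move=> t b t' b' t'' b'' _ [H1 H2] _ [H3 H4]; rewrite (perm_trans H1) ?(perm_trans H2).
- by move=> p x r y s p' r' s'; split; apply/permP=> a; do ![rewrite count_cat /=]; clear; lia.
- by move=> p x q y r z s p' q' r' s'; split; apply/permP=> a; do ![rewrite count_cat /=]; clear; lia.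
by move=> p x q y r z s p' q' r' s'; split; apply/permP=> a; do ![rewrite count_cat /=]; clear; lia.
Qed.

Definition insert_at (e c : T) x := if x == e then [:: c] else [::].

Lemma insert_at_notin e c w : e \notin w -> insert_before (insert_at e c) w = w.
Proof.
elim: w => //= x w IH; rewrite inE negb_or /insert_at eq_sym => /andP [/negPf-> /IH].
by rewrite /insert_at => ->.
Qed.

Lemma insert_at_uniq e c u v : uniq (u ++ e :: v) ->
  insert_before (insert_at e c) (u ++ e :: v) = u ++ c :: e :: v.
Proof.
rewrite cat_uniq /= negb_or => /and3P [_ /andP [H1 _] /andP [H2 _]].
by rewrite insert_before_cat /= !insert_at_notin // /insert_at eqxx.
Qed.

Lemma perm_rev_block t b B : perm_eq (t ++ B) (b ++ rev B) -> perm_eq t b.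
Proof.
move=> H; rewrite -(perm_cat2r B) (perm_trans H) //.
by rewrite perm_cat2l perm_rev.
Qed.

(* Delete the last letter [c] of the top word, bring the rest to blocks by induction,
   and put [c] back in the bottom word in front of its former successor [e]; at
   most two exchanges then produce a last block. *)
Lemma sim_realizes_blocks t b : uniq t -> perm_eq t b -> exists s, 0 \notin s /\ sim_realizes t b s.
Proof.
have [n] := ubnP (size t); elim: n t b => // n IH t b /ltnSE Hn Hu Hp.
case/lastP: t => [|t c] in Hn Hu Hp *.
  exists [::]; split=> //; move: Hp; rewrite perm_sym => /perm_nilP ->.
  by exists [::], [::]; split; [exact: realizes0|exact: sim_refl].
suff [t2 [b2 [B [HB Hs]]]] : exists t2 b2 B, B != [::] /\
    sim (rcons t c) b (t2 ++ B) (b2 ++ rev B).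
  have [P1 P2] := sim_perm Hs.
  have Hp2 : perm_eq (t2 ++ B) (b2 ++ rev B).
    by rewrite perm_sym in P1; apply: perm_trans P1 (perm_trans Hp P2).
  have Hu2 : uniq (t2 ++ B) by rewrite -(perm_uniq P1).
  have HB0 : 0 < size B by case: B HB {Hs P1 P2 Hp2 Hu2}.
  have [||s [Hs0 Hs2]] := IH t2 b2 _ _ (perm_rev_block Hp2).
  - by move: Hn; rewrite (perm_size P1) size_cat; clear -HB0; lia.
  - by move: Hu2; rewrite cat_uniq => /andP [].
  exists (s ++ [:: size B]); split; first by rewrite mem_cat (negPf Hs0) inE eq_sym -lt0n HB0.
  by apply: sim_realizes_trans Hs _; apply: sim_realizes_cat => //; apply: realizes_blk.
have Hcb : c \in b by rewrite -(perm_mem Hp) mem_rcons inE eqxx.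
move: Hp; case/splitPr: b / Hcb => b1 b2; case: b2 => [|e b2] Hp.
  by exists t, b1, [:: c]; split=> //; rewrite -cats1; apply: sim_refl.
have Hu1 : uniq t by move: Hu; rewrite rcons_uniq => /andP [].
have Hp1 : perm_eq t (b1 ++ e :: b2).
  rewrite -(perm_cons c) -perm_rcons (perm_trans Hp) //.
  by apply/permP=> a; do ![rewrite count_cat /=]; clear; lia.
have [|s [Hs0 [F [G [[cs [Ecs EF EG]] HFG]]]]] := IH t (b1 ++ e :: b2) _ Hu1 Hp1.
  by move: Hn; rewrite size_rcons.
have [PF PG] := sim_perm HFG.
have HuG : uniq G by rewrite -(perm_uniq PG) -(perm_uniq Hp1).
have HuF : uniq F by rewrite -(perm_uniq PF).
have eG : e \in G by rewrite -(perm_mem PG) mem_cat inE eqxx orbT.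
have eF : e \in F by rewrite -(perm_mem PF) (perm_mem Hp1) mem_cat inE eqxx orbT.
have H1 : sim (rcons t c) (b1 ++ c :: e :: b2) (F ++ [:: c]) (insert_before (insert_at e c) G).
  have := sim_app [:: c] [::] (sim_insert (fun _ => [::]) (insert_at e c) HFG).
  by rewrite !insert_before_nil !cats0 cats1 insert_at_uniq // -(perm_uniq Hp1).
suff [t2 [b3 [B [HB Hs]]]] : exists t2 b2 B, B != [::] /\
    sim (F ++ [:: c]) (insert_before (insert_at e c) G) (t2 ++ B) (b2 ++ rev B).
  by exists t2, b3, B; split=> //; apply: sim_trans H1 Hs.
move: Ecs EF EG; case/lastP: cs => [|cs D] Ecs EF EG; first by rewrite EF in eF.
have HD : D != [::].
  by apply: contraNneq Hs0 => D0; rewrite -Ecs map_rcons mem_rcons D0 inE eqxx.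
move: EF EG; rewrite map_rcons !flatten_rcons; set F1 := flatten cs; set G1 := flatten _ => EF EG.
have eG1 : (e \in G1) = (e \in F1).
  rewrite /G1 /F1; elim: (cs) => //= w ws IHw; rewrite !mem_cat mem_rev; congr (_ || _).
  exact: IHw.
rewrite {}EG in HuG *; rewrite {}EF in HuF eF *.
(* If [e] lies before the last block [D], the new last block consists of [e] and one other letter:
   [c] if [D] is a single letter, else the second letter of [D]. If [e] lies in [D], it consists of
   [D] up to [e] and one further letter. *)
case: (boolP (e \in F1)) => eF1.
  have : e \in G1 by rewrite eG1.
  move: eF1 HuG => /splitPr [T1 T2] HuG eG1'; move: HuG.
  case/splitPr: G1 / eG1' {eG1} => S1 S2; rewrite -catA /= => HuG.
  rewrite insert_at_uniq //; case: D HD {Ecs HuF HuG eF} => [//|x1 [|x2 R]] _.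
    exists (T2 ++ x1 :: T1), (S2 ++ x1 :: S1), [:: e; c]; split=> //.
    rewrite -[rev [:: x1]]/[:: x1] -[rev [:: e; c]]/[:: c; e]. swap2 e x1. exact: sim_refl.
  exists (R ++ c :: T2 ++ x1 :: T1), (x1 :: S1 ++ c :: S2 ++ rev R), [:: e; x2]; split=> //.
  rewrite -[rev [:: e; x2]]/[:: x2; e] !rev_cons -!cats1; swap2 e x1; swap2 x2 c. exact: sim_refl.
have eD : e \in rev D by move: eF; rewrite mem_cat (negPf eF1) mem_rev.
have ED : D = rev (rev D) by rewrite revK.
move: eD HuG ED; move: (rev D) => D' eD HuG ED; move: HuG.
case/splitPr: D' / eD ED => S1 S2 ED HuG.
rewrite catA in HuG *; rewrite insert_at_uniq // ED rev_cat rev_cons.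
case/lastP: S1 {HuG ED} => [|S1 y].
  exists F1, G1, (rcons (rev S2) e ++ [:: c]); split; first by case: (rev S2).
  rewrite -[rev [::]]/[::] rev_cat rev_rcons revK -[rev [:: c]]/[:: c] !cats0 -!catA; exact: sim_refl.
exists (rev S1 ++ c :: F1), (c :: G1 ++ S1), (rev S2 ++ [:: e; y]); split; first by case: (rev S2).
rewrite rev_rcons rev_cat revK -!cats1.
rewrite -[rev [:: e; y]]/[:: y; e]; swap2 y c; exact: sim_refl.
Qed.

End Exists.

(** * Induction on the length: every pair of middle words reaches one of the types *)

Section Typed.
Variable T : eqType.
Implicit Types (t b u v w : seq T).

Definition sim_typed t b := exists s, [/\ typed s, 0 \notin s & sim_realizes t b s].

Lemma sim_typed_good t b s : sim_realizes t b s -> good T s -> sim_typed t b.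
Proof.
move=> [t' [b' [Hr H]]] [s' [H1 H2 Hs]]; exists s'; split=> //.
by apply: sim_realizes_trans H _; apply: Hs.
Qed.

Lemma realizes_last_block A B (t b : seq T) k j : 1 < k -> 3 < j ->
  realizes ((A ++ k :: B) ++ [:: j]) t b ->
  exists t' b' x y, sim t b (t' ++ [:: x; y]) (b' ++ [:: y; x]).
Proof.
move=> Hk Hj; rewrite -catA /=.
move=> /realizes_cat [A1 [A2 [t1 [b1 [_ + -> ->]]]]].
move=> /realizes_cons [w [t2 [b2 [Hw /realizes_cat [B1 [B2 [t3 [b3 [_ + -> ->]]]]] -> ->]]]].
move=> /realizes_cons [W [t4 [b4 [HW /realizes_nil [-> ->] -> ->]]]].
case: w Hw => [|p [|q R]] Hw; [by move: Hk; rewrite -Hw..|].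
case: W HW => [|g [|h W]] HW; [by move: Hj; rewrite -HW..|].
case/lastP: W HW => [|W i'] HW; first by move: Hj; rewrite -HW.
case/lastP: W HW => [|Y i] HW; first by move: Hj; rewrite -HW.
have [t' [b' H]] := sim_last_block A1 [::] (R ++ B1) (A2 ++ rev R) [::] B2 Y (rev Y) p q g h i i'.
exists t', b', i, h; apply: sim_cast H _ _ _ _ => //; rewrite !cats0 /=.
  by rewrite -!cats1; do ?[rewrite -!catA /=].
by rewrite !rev_cons !rev_rcons -!cats1; do ?[rewrite -!catA /=].
Qed.

Lemma typed_singleton j : 1 < j -> typed [:: j].
Proof. by case: j => [|[|j]]. Qed.

Lemma sim_typed_all t b : uniq t -> perm_eq t b -> sim_typed t b.
Proof.
have [n] := ubnP (size t); elim: n t b => // n IH t b /ltnSE Hn Hu Hp.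
(* Any last block, however found, leaves shorter words before it, which get a type by induction.
   This is used once for the given last block and again after it has been turned into a 2-block,
   since that change destroys the typing of the rest. *)
have front u v t2 b2 : sim t b (u ++ t2) (v ++ b2) -> 0 < size t2 -> b2 = rev t2 ->
    exists s, [/\ typed s, 0 \notin s & sim_realizes t b (s ++ [:: size t2])].
  move=> H H0 Eb; have [P1 P2] := sim_perm H.
  have Hp2 : perm_eq (u ++ t2) (v ++ rev t2).
    by rewrite -Eb; rewrite perm_sym in P1; apply: perm_trans P1 (perm_trans Hp P2).
  have [||s [Hs1 Hs2 Hs3]] := IH u v _ _ (perm_rev_block Hp2).
  - by move: Hn; rewrite (perm_size P1) size_cat; clear -H0; lia.
  - by move: Hu; rewrite (perm_uniq P1) cat_uniq => /andP [].
  exists s; split=> //; apply: sim_realizes_trans H _; apply: sim_realizes_cat => //.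
  by rewrite Eb; apply: realizes_blk.
have [s [Hs0 [t' [b' [Hr Hsim]]]]] := sim_realizes_blocks Hu Hp.
case/lastP: s Hs0 Hr => [|s j] Hs0 Hr; first by exists [::]; split=> //; exists t', b'.
have Hj : 0 < j by rewrite lt0n; apply: contraNneq Hs0 => <-; rewrite mem_rcons inE eqxx.
rewrite -cats1 in Hr.
case: (realizes_cat Hr) => [u [v [t2 [b2 [Hr1 Hr2 Et Eb]]]]].
case: (realizes_cons Hr2) => [w [? [? [Hw /realizes_nil [-> ->]]]]]; rewrite !cats0 => Et2 Eb2.
subst t' b' t2 b2.
have [||L [HL HL0]] := front u v w (rev w) Hsim; rewrite ?Hw // => HLr.
have [j4|] := ltnP 3 j; last first.
  case: j Hj {Hs0 Hr Hr2 Hw} HLr => [//|[|[|[|//]]]] _ HLr _.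
  - exists (L ++ [:: 1]); split=> //; first exact: typed_cat1.
    by rewrite mem_cat (negPf HL0).
  - by apply: sim_typed_good HLr (good_cat2 _ HL HL0).
  - by apply: sim_typed_good HLr (good_cat3 _ HL HL0).
case: (boolP (has (leq 2) L)) => [/hasP [k kL Hk]|L1]; last first.
  exists (L ++ [:: j]); split=> //; last by rewrite mem_cat (negPf HL0) inE; clear -j4; lia.
  suff -> : L = nseq (size L) 1 by apply/typed_ones/typed_singleton; clear -j4; lia.
  apply/all_pred1P/allP=> x Hx; move/hasPn/(_ _ Hx): L1.
  have : x != 0 by apply: contraNneq HL0 => <-.
  by clear; rewrite /=; lia.
case/splitPr: kL HL HL0 HLr => A B _ _ [t1 [b1 [Hr' H']]].
have [t2 [b2 [x [y H2]]]] := realizes_last_block Hk j4 Hr'.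
have [||s' [Hs1 Hs2 Hs3]] := front t2 b2 [:: x; y] [:: y; x] (sim_trans H' H2) => //.
exact: sim_typed_good Hs3 (good_cat2 _ Hs1 Hs2).
Qed.

End Typed.

(** * Rauzy moves on words *)

Section Rots.
Variable T : Type.
Implicit Types (t b u v w : seq T).

(* Iterating a Rauzy move rotates the part of the losing row that follows the winner
   [z], the last letter of the winning row. *)
Inductive rots : seq T -> seq T -> seq T -> seq T -> Prop :=
| rots_refl t b : rots t b t b
| rots_trans t b t' b' t'' b'' : rots t b t' b' -> rots t' b' t'' b'' -> rots t b t'' b''
| rots_bot t b z u v : rots (t ++ [:: z]) (b ++ z :: u ++ v) (t ++ [:: z]) (b ++ z :: v ++ u)
| rots_top t b z u v : rots (t ++ z :: u ++ v) (b ++ [:: z]) (t ++ z :: v ++ u) (b ++ [:: z]).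

Lemma rots_sym t b t' b' : rots t b t' b' -> rots t' b' t b.
Proof.
elim=> {t b t' b'} [t b|t b t' b' t'' b'' _ IH1 _ IH2|t b z u v|t b z u v].
- exact: rots_refl.
- exact: rots_trans IH2 IH1.
- exact: rots_bot.
- exact: rots_top.
Qed.

Lemma rots_flip t b t' b' : rots t b t' b' -> rots b t b' t'.
Proof.
elim=> {t b t' b'} [t b|t b t' b' t'' b'' _ IH1 _ IH2|t b z u v|t b z u v].
- exact: rots_refl.
- exact: rots_trans IH1 IH2.
- exact: rots_top.
- exact: rots_bot.
Qed.

Lemma rots_cast t b t' b' t1 b1 t1' b1' :
  rots t b t' b' -> t1 = t -> b1 = b -> t1' = t' -> b1' = b' -> rots t1 b1 t1' b1'.
Proof. by move=> ? -> -> -> ->. Qed.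

Local Ltac rot H := apply: rots_trans; first (apply: (rots_cast H); [words_solve|words_solve|reflexivity|reflexivity]).

(** The winners are in turn [c], [x], [y], [a]: each rotation brings the next winner to the end of
    the losing row, and the last one restores the ends. For [rots_swap3] they are [c], [x], [y],
    [z], [c]. *)
Lemma rots_swap2 (a c x y : T) p r s p' r' s' :
  rots (a :: (p ++ x :: r ++ y :: s) ++ [:: c]) (c :: (p' ++ x :: r' ++ y :: s') ++ [:: a])
       (a :: (r ++ y :: p ++ x :: s) ++ [:: c]) (c :: (r' ++ y :: p' ++ x :: s') ++ [:: a]).
Proof.
rot (rots_bot (a :: p ++ x :: r ++ y :: s) [::] c (p' ++ [:: x]) (r' ++ y :: s' ++ [:: a])).
rot (rots_top (a :: p) (c :: r' ++ y :: s' ++ a :: p') x (r ++ [:: y]) (s ++ [:: c])).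
rot (rots_bot (a :: p ++ x :: s ++ c :: r) (c :: r') y (s' ++ [:: a]) (p' ++ [:: x])).
rot (rots_top [::] (c :: r' ++ y :: p' ++ x :: s') a (p ++ x :: s ++ [:: c]) (r ++ [:: y])).
by apply: (rots_cast (rots_refl _ _)); words_solve.
Qed.

Lemma rots_swap3 (a c x y z : T) p q r s p' q' r' s' :
  rots (a :: (p ++ x :: q ++ y :: r ++ z :: s) ++ [:: c]) (c :: (p' ++ y :: q' ++ z :: r' ++ x :: s') ++ [:: a])
       (a :: (p ++ x :: r ++ z :: q ++ y :: s) ++ [:: c]) (c :: (p' ++ y :: r' ++ x :: q' ++ z :: s') ++ [:: a]).
Proof.
rot (rots_bot (a :: p ++ x :: q ++ y :: r ++ z :: s) [::] c (p' ++ y :: q' ++ z :: r' ++ [:: x]) (s' ++ [:: a])).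
rot (rots_top (a :: p) (c :: s' ++ a :: p' ++ y :: q' ++ z :: r') x (q ++ [:: y]) (r ++ z :: s ++ [:: c])).
rot (rots_bot (a :: p ++ x :: r ++ z :: s ++ c :: q) (c :: s' ++ a :: p') y (q' ++ [:: z]) (r' ++ [:: x])).
rot (rots_top (a :: p ++ x :: r) (c :: s' ++ a :: p' ++ y :: r' ++ x :: q') z (s ++ [:: c]) (q ++ [:: y])).
rot (rots_bot (a :: p ++ x :: r ++ z :: q ++ y :: s) [::] c (s' ++ [:: a]) (p' ++ y :: r' ++ x :: q' ++ [:: z])).
by apply: (rots_cast (rots_refl _ _)); words_solve.
Qed.

Lemma sim_rots a c t b t' b' : sim t b t' b' ->
  rots (a :: t ++ [:: c]) (c :: b ++ [:: a]) (a :: t' ++ [:: c]) (c :: b' ++ [:: a]).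
Proof.
elim=> {t b t' b'}.
- by move=> t b; apply: rots_refl.
- by move=> t b t' b' _; apply: rots_sym.
- by move=> t b t' b' t'' b'' _ H1 _ H2; apply: rots_trans H1 H2.
- by move=> *; apply: rots_swap2.
- by move=> *; apply: rots_swap3.
by move=> *; apply/rots_flip/rots_swap3.
Qed.

End Rots.

(** * Rauzy's lemma: reaching a standard pair *)

Section Standard.
Variable T : eqType.
Implicit Types (t b u v w : seq T).

Lemma rots_perm t b t' b' : rots t b t' b' -> perm_eq t t' /\ perm_eq b b'.
Proof.
elim=> {t b t' b'} [//|t b t' b' t'' b'' _ [H1 H2] _ [H3 H4]|t b z u v|t b z u v].
- by rewrite (perm_trans H1) // (perm_trans H2).
- by rewrite perm_refl perm_cat2l perm_cons perm_catC.
- by rewrite perm_refl perm_cat2l perm_cons perm_catC.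
Qed.

Definition irreducible_words t b := forall k, 0 < k < size t -> ~~ perm_eq (take k t) (take k b).

Lemma irreducible_words_sym t b : size t = size b -> irreducible_words t b -> irreducible_words b t.
Proof. by move=> E H k; rewrite -E perm_sym; apply: H. Qed.

(** A proper prefix of the top word misses its last letter [z], so a bottom prefix with the same
    letters ends before [z], where the rotation changes nothing. *)
Lemma irreducible_words_bot t b z u v : uniq (t ++ [:: z]) ->
  irreducible_words (t ++ [:: z]) (b ++ z :: u ++ v) -> irreducible_words (t ++ [:: z]) (b ++ z :: v ++ u).
Proof.
move=> Hu H k Hk; have := H k Hk; apply: contraNN => Hp.
have k1 : k <= size t by move: Hk; rewrite size_cat /=; clear; lia.
have zt : z \notin t by move: Hu; rewrite cats1 rcons_uniq => /andP [].
have : z \notin take k (t ++ [:: z]).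
  by rewrite takel_cat //; apply: contraNN zt; apply: mem_take.
rewrite (perm_mem Hp).
have [k2 _|k2] := leqP k (size b); last first.
  by rewrite take_cat ltnNge ltnW //= -[k - _]prednK ?subn_gt0 //= mem_cat inE eqxx orbT.
by have -> : take k (b ++ z :: u ++ v) = take k (b ++ z :: v ++ u) by rewrite !takel_cat.
Qed.

Lemma perm_take t b k : uniq t -> uniq b -> size t = size b ->
  {subset take k t <= take k b} -> perm_eq (take k t) (take k b).
Proof.
move=> Ut Ub E H; apply: uniq_perm; rewrite ?take_uniq //.
have sz : size (take k b) <= size (take k t) by rewrite !size_take E.
by have [] := uniq_min_size (take_uniq k Ut) H sz.
Qed.

(* Rauzy: unless [z] comes first in the bottom row, irreducibility gives letters [y]
   before and [x] after [z] in the bottom row with [x] before [y] in the top row;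
   making first [x], then [y], the last letter of its row moves the bottom
   position of the last top letter to the left. *)
Lemma standard_rots t b z b' : uniq (t ++ [:: z]) -> perm_eq (t ++ [:: z]) (b ++ z :: b') ->
  irreducible_words (t ++ [:: z]) (b ++ z :: b') -> 0 < size t ->
  exists x y t1 b1, rots (t ++ [:: z]) (b ++ z :: b') (x :: t1 ++ [:: y]) (y :: b1 ++ [:: x]).
Proof.
have [n] := ubnP (size b); elim: n t b z b' => // n IH t b z b' /ltnSE Hn Hu Hp Hi Ht.
have Ub : uniq (b ++ z :: b') by rewrite -(perm_uniq Hp).
case: b => [|b0 b] in Hn Hp Hi Ub *.
  (* Here [z] comes first in the bottom row, and one rotation behind it brings the first top letter
     [x] to the end. *)
  case: t Hu Hp Hi Ht => [//|x t] Hu Hp Hi _.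
  have : x \in [::] ++ z :: b' by rewrite -(perm_mem Hp) mem_head.
  rewrite inE; case: eqP => [E|_ /=]; first by move: Hu; rewrite E /= mem_cat mem_head orbT.
  case/splitPr=> u v; exists x, z, t, (v ++ u).
  by apply: (rots_cast (rots_bot (x :: t) [::] z (u ++ [:: x]) v)); words_solve.
move: (b0 :: b) (isT : 0 < size (b0 :: b)) => {b0}b Hb in Hn Hp Hi Ub *.
set W := t ++ [:: z] in Hu Hp Hi *; set B := b ++ z :: b' in Hp Hi Ub *.
have EB : take (size b) B = b by rewrite take_size_cat.
have Hsz := perm_size Hp.
have bt : size b <= size t by move: Hsz; rewrite !size_cat /=; clear; lia.
have zt : z \notin t by move: Hu; rewrite /W cats1 rcons_uniq => /andP [].
have HN : ~~ perm_eq (take (size b) W) (take (size b) B).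
  by apply: Hi; rewrite Hb /= size_cat addn1 ltnS.
(* Two different sets of the same size: neither contains the other, so both [x] and [y] exist. *)
have [x xW xb] : exists2 x, x \in take (size b) W & x \notin b.
  apply/hasP; apply: contraNT HN => /hasPn H; apply: perm_take => // x /H.
  by rewrite negbK EB.
have [y yb yW] : exists2 y, y \in b & y \notin take (size b) W.
  apply/hasP; apply: contraNT HN => /hasPn H; rewrite perm_sym; apply: perm_take => // y.
  by rewrite EB => /H; rewrite negbK.
have {xW} xt : x \in take (size b) t by move: xW; rewrite takel_cat.
have xz : x != z by apply: contraNneq zt => <-; apply: mem_take xt.
have xb' : x \in b'.
  have : x \in B by rewrite -(perm_mem Hp) mem_cat (mem_take xt).
  by rewrite mem_cat inE (negPf xb) (negPf xz).
have yt : y \in drop (size b) W.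
  have : y \in W by rewrite (perm_mem Hp) mem_cat yb.
  by rewrite -{1}(cat_take_drop (size b) W) mem_cat (negPf yW).
have EW : W = take (size b) t ++ drop (size b) W.
  by rewrite -[LHS](cat_take_drop (size b)) {1}/W takel_cat.
move: xt yt EW; move: (take _ t) (drop _ W) => W1 W2 /splitPr [p1 p2] /splitPr [q1 q2] EW.
case/splitPr: xb' @B Hp Hi Ub EB HN Hsz => u v B Hp Hi Ub EB HN Hsz.
have R1 : rots W B W (b ++ z :: v ++ (u ++ [:: x])).
  by apply: (rots_cast (rots_bot t b z (u ++ [:: x]) v)); rewrite // /B; words_solve.
have I1 : irreducible_words W (b ++ z :: v ++ (u ++ [:: x])).
  by apply: irreducible_words_bot => //; move: Hi; rewrite /B -catA.
have [P1 P1'] := rots_perm R1.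
pose W' := p1 ++ x :: q2 ++ (p2 ++ q1 ++ [:: y]).
have EW2 : W = p1 ++ x :: (p2 ++ q1 ++ [:: y]) ++ q2 by rewrite EW; words_solve.
have EB2 : b ++ z :: v ++ u ++ [:: x] = (b ++ z :: v ++ u) ++ [:: x] by words_solve.
have R2 : rots W (b ++ z :: v ++ (u ++ [:: x])) W' (b ++ z :: v ++ (u ++ [:: x])).
  by rewrite EW2 EB2; apply: rots_top.
have I2 : irreducible_words W' (b ++ z :: v ++ (u ++ [:: x])).
  have S1 : size W = size (b ++ z :: v ++ u ++ [:: x]).
    by rewrite (perm_size Hp) (perm_size P1').
  apply: irreducible_words_sym; first by rewrite -S1 /W' EW2 !size_cat /= !size_cat /=; clear; lia.
  rewrite EB2; apply: irreducible_words_bot; first by rewrite -EB2 -(perm_uniq P1').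
  by rewrite -EB2 -EW2; apply: irreducible_words_sym.
have [P2 _] := rots_perm R2.
have EW' : W' = (p1 ++ x :: q2 ++ p2 ++ q1) ++ [:: y] by rewrite /W'; words_solve.
have P3 : perm_eq W' (b ++ z :: v ++ (u ++ [:: x])).
  by rewrite perm_sym in P2; apply: perm_trans P2 (perm_trans Hp P1').
have R3 := rots_trans R1 R2; move: R3 I2 P3; rewrite EW'.
have [c [d Eb]] : exists c d, b = c ++ y :: d by case/splitPr: yb => c d; exists c, d.
have -> : b ++ z :: v ++ u ++ [:: x] = c ++ y :: (d ++ z :: v ++ u ++ [:: x]) by rewrite Eb -catA.
move=> R3 I2 P3.
have [|||x1 [y1 [t1 [b1 R4]]]] := IH _ _ _ _ _ _ P3 I2.
- by move: Hn; rewrite Eb size_cat /=; clear; lia.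
- by rewrite -EW' -(perm_uniq P2).
- by rewrite size_cat /= addnS.
by exists x1, y1, t1, b1; apply: rots_trans R3 R4.
Qed.

End Standard.

(** * Positions inside a reversed block, and block bounds as partial sums *)

Section Index.
Variable T : eqType.
Implicit Types (u v w : seq T).

Lemma index_block u v w x : uniq (u ++ w ++ v) ->
  (size u <= index x (u ++ w ++ v) < size u + size w) = (x \in w).
Proof.
move=> Hu; rewrite !index_cat; case: ifP => xu.
  have -> : (x \in w) = false.
    by move: Hu; rewrite cat_uniq => /and3P [_ /hasPn H _]; apply: contraTF xu => xw;
      rewrite H // mem_cat xw.
  by have := index_mem x u; rewrite xu; clear; lia.
by case: ifP => xw; have := index_mem x w; rewrite xw; clear; lia.
Qed.

Lemma index_rev w x : uniq w -> x \in w -> (index x w + index x (rev w)).+1 = size w.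
Proof.
move=> Hu /splitPr H; case: H Hu => u v Hu.
have [xu xv] : x \notin u /\ x \notin v.
  move: Hu; rewrite cat_uniq /= negb_or => /and3P [_ /andP [H _] /andP [H' _]].
  by split.
rewrite rev_cat rev_cons cat_rcons !index_cat mem_rev (negPf xu) (negPf xv) /= eqxx.
by rewrite size_rev size_cat /=; clear; lia.
Qed.

End Index.

Lemma consec_scanl (T : Type) m (cs : seq (seq T)) kk :
  kk \in consec (m :: scanl addn m (map size cs)) ->
  exists c1 w c2, [/\ cs = c1 ++ w :: c2, kk.1 = m + size (flatten c1) & kk.2 = kk.1 + size w].
Proof.
elim: cs m => [|w cs IH] m //=; rewrite inE => /orP [/eqP ->|/IH].
  by exists [::], w, cs; rewrite addn0.
by move=> [c1 [v [c2 [-> -> ->]]]]; exists (w :: c1), v, c2; rewrite /= size_cat addnA.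
Qed.

Lemma block_sizes_scanl m s : block_sizes (m :: scanl addn m s) = s.
Proof.
elim: s m => [|k s IH] m //=; rewrite /block_sizes /= addKn; congr (_ :: _); exact: IH.
Qed.

Lemma sorted_scanl m s : 0 \notin s -> sorted ltn (m :: scanl addn m s).
Proof.
elim: s m => [|k s IH] m //=; rewrite inE negb_or => /andP [k0 /IH H].
by rewrite -[X in X < _]addn0 ltn_add2l lt0n eq_sym k0; apply: H.
Qed.

Lemma last_scanl m s : last 0 (m :: scanl addn m s) = m + sumn s.
Proof. by elim: s m => [|k s IH] m /=; rewrite ?addn0 // -[LHS]/(last 0 (m + k :: _)) IH addnA. Qed.

(** * From words back to pairs of position functions *)

Section Pairs.
Variable A : finType.
Implicit Types (p q : pair_on A) (e : bool) (w u v t b : seq A).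

Definition row_is p e w := [/\ uniq w, forall x, x \in w & forall x, pos p e x = (index x w).+1].

Lemma row_is_size p e w : row_is p e w -> size w = #|A|.
Proof.
case=> Hu Hw _; rewrite -(card_uniqP Hu); apply: eq_card => x; exact: Hw.
Qed.

(** Sorting the alphabet by position gives [#|A|] distinct increasing numbers between 1 and [#|A|],
    hence all of them in order. *)
Lemma row_exists p e : is_pair p -> exists w, row_is p e w.
Proof.
move=> /(_ e) [inj Hp].
pose w := sort (relpre (pos p e) leq) (enum A).
have Hu : uniq w by rewrite sort_uniq enum_uniq.
have Hw x : x \in w by rewrite mem_sort mem_enum.
have Hs : size w = #|A| by rewrite size_sort -cardE.
have Um : uniq (map (pos p e) w) by rewrite map_inj_uniq.
have Hsub : {subset map (pos p e) w <= iota 1 #|A|}.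
  by move=> i /mapP [x _ ->]; rewrite mem_iota add1n ltnS.
have Hsz : size (iota 1 #|A|) <= size (map (pos p e) w) by rewrite size_iota size_map Hs.
have Em : map (pos p e) w = iota 1 #|A|.
  apply: (sorted_eq leq_trans anti_leq).
  - rewrite sorted_map; apply: sort_sorted => x y; exact: leq_total.
  - exact: iota_sorted.
  apply: uniq_perm => //; first exact: iota_uniq.
  by have [] := uniq_min_size Um Hsub Hsz.
exists w; split=> // x.
have Hx : index x w < #|A| by rewrite -Hs index_mem.
by rewrite -add1n -(nth_iota 0 1 Hx) -Em (nth_map x) ?Hs // nth_index.
Qed.

Lemma rauzy_rotate p e t b z u c : row_is p e (t ++ [:: z]) -> row_is p (~~ e) (b ++ z :: u ++ [:: c]) ->
  exists q, [/\ rauzy_move e p q, row_is q e (t ++ [:: z]) & row_is q (~~ e) (b ++ z :: c :: u)].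
Proof.
move=> H1 H2.
have S1 := row_is_size H1; have S2 := row_is_size H2.
case: H1 => U1 M1 P1; case: H2 => U2 M2 P2.
pose f x := (index x (t ++ [:: z])).+1; pose g x := (index x (b ++ z :: c :: u)).+1.
pose q : pair_on A := if e then (g, f) else (f, g).
have qe x : pos q e x = f x by rewrite /q; case: (e).
have qe' x : pos q (~~ e) x = g x by rewrite /q; case: (e).
have Hperm : perm_eq (b ++ z :: u ++ [:: c]) (b ++ z :: c :: u).
  by rewrite perm_cat2l perm_cons -[c :: u]cat1s perm_catC.
exists q; split; last 1 first.
- split=> [|x|x]; [by rewrite -(perm_uniq Hperm)|by rewrite -(perm_mem Hperm)|exact: qe'].
- exists z; split; last split.
  + rewrite P1 -S1 index_cat size_cat /= eqxx addn0 addn1.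
    by case: ifP => // zt; move: U1; rewrite cats1 rcons_uniq zt.
  + by move=> a; rewrite qe P1.
  move=> a; rewrite qe' !P2 /g /= -S2.
  move: (U2); rewrite cat_uniq /= mem_cat inE !negb_or cat_uniq /= orbF.
  case/and3P=> _ /andP [zb /hasPn Hb] /and4P [/andP [zu zc] uu cu _].
  have cb : c \notin b by apply: Hb; rewrite mem_cat mem_head orbT.
  rewrite !index_cat (negPf zb) /= !index_cat eqxx (eq_sym z a) (eq_sym c a).
  have [ab|ab] := boolP (a \in b).
    by have := index_mem a b; rewrite ab; clear; rewrite size_cat /= size_cat /=; case: ifP; lia.
  have [_|az] := eqVneq a z; first by rewrite addn0 leqnn.
  have [->|ac] := eqVneq a c.
    by rewrite (negPf cu) /= eqxx size_cat /= size_cat /=; clear; case: ifP; [lia|case: ifP; lia].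
  have au : a \in u.
    by have := M2 a; rewrite mem_cat (negPf ab) inE (negPf az) mem_cat inE (negPf ac) orbF.
  have ia : index a u < size u by rewrite index_mem.
  rewrite au size_cat /= size_cat /=; clear -ia.
  case: ifP => [H|_]; first lia. by case: ifP => H; lia.
by split.
Qed.

(** Each Rauzy move puts the last letter of the losing row directly behind the winner, so the
    letters of [v] are moved one at a time from the right. *)
Lemma class_rotate p e t b z u v : row_is p e (t ++ [:: z]) -> row_is p (~~ e) (b ++ z :: u ++ v) ->
  exists q, [/\ in_rauzy_class p q, row_is q e (t ++ [:: z]) & row_is q (~~ e) (b ++ z :: v ++ u)].
Proof.
elim/last_ind: v u p => [|v c IH] u p H1 H2.
  by exists p; split=> //; [exact: rt_refl|rewrite cats0 in H2].
rewrite -cats1 catA in H2.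
have [q [Hq Q1 Q2]] := rauzy_rotate H1 H2.
rewrite -cat_cons in Q2.
have [r [Hr R1 R2]] := IH _ _ Q1 Q2.
exists r; split=> //; last by rewrite cat_rcons.
by apply: rt_trans Hr; apply: rt_step; exists e.
Qed.

Lemma rots_class t b t' b' p : rots t b t' b' -> row_is p false t -> row_is p true b ->
  exists q, [/\ in_rauzy_class p q, row_is q false t' & row_is q true b'].
Proof.
move=> H; elim: H p => {t b t' b'} [t b|t b t' b' t'' b'' _ IH1 _ IH2|t b z u v|t b z u v] p H1 H2.
- by exists p; split=> //; apply: rt_refl.
- have [q [Hq Q1 Q2]] := IH1 p H1 H2; have [r [Hr R1 R2]] := IH2 q Q1 Q2.
  by exists r; split=> //; apply: rt_trans Hq Hr.
- exact: (@class_rotate p false).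
by have [q [? ? ?]] := (@class_rotate p true b t z u v H2 H1); exists q.
Qed.

Lemma irreducible_rows p t b : irreducible p -> row_is p false t -> row_is p true b ->
  irreducible_words t b.
Proof.
move=> Hi H1 H2 k; rewrite (row_is_size H1) => /Hi.
case: H1 => _ M1 P1; case: H2 => _ M2 P2; apply: contraNN => Hp.
by apply/eqP/setP=> a; rewrite !inE P1 P2 -!in_take // (perm_mem Hp).
Qed.

(** The bounds start at 2 because the first letter of each row is not in the middle words. A letter
    with index [i] in a block [w] and [j] in [rev w] has [i + j + 1 = size w]; adding the lower
    bound twice gives the required sum of positions. *)
Lemma por_blocks_realizes q x y s t b : row_is q false (x :: t ++ [:: y]) ->
  row_is q true (y :: b ++ [:: x]) -> 0 \notin s -> realizes s t b ->
  por_blocks q (2 :: scanl addn 2 s).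
Proof.
move=> H1 H2 Hs0 [cs [Es Et Eb]]; split=> //; split.
  rewrite last_scanl -(row_is_size H1) /= size_cat Et size_flatten /shape Es /=; clear; lia.
split; first exact: sorted_scanl.
move=> kk; rewrite -Es => /consec_scanl [c1 [w [c2 [Ecs -> ->]]]].
case: H1 => U1 _ P1; case: H2 => U2 _ P2.
have E1 : x :: t ++ [:: y] = (x :: flatten c1) ++ w ++ (flatten c2 ++ [:: y]).
  by rewrite Et Ecs flatten_cat /= -!catA.
have E2 : y :: b ++ [:: x] = (y :: flatten (map rev c1)) ++ rev w ++ (flatten (map rev c2) ++ [:: x]).
  by rewrite Eb Ecs map_cat flatten_cat /= -!catA.
have Es1 : size (flatten (map rev c1)) = size (flatten c1).
  by rewrite !size_flatten /shape -map_comp; congr sumn; apply: eq_map => v /=; rewrite size_rev.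
have Q1 a : (2 + size (flatten c1) <= pos q false a < 2 + size (flatten c1) + size w) = (a \in w).
  rewrite P1 E1 -(index_block a (eq_ind _ (fun l => uniq l) U1 _ E1)) /=; clear; lia.
have Q2 a : (2 + size (flatten c1) <= pos q true a < 2 + size (flatten c1) + size w) = (a \in w).
  rewrite P2 E2 -(mem_rev w) -(index_block a (eq_ind _ (fun l => uniq l) U2 _ E2)) /= Es1 size_rev.
  clear; lia.
split=> a; first by rewrite Q1 Q2.
rewrite Q1 => aw.
have Uw : uniq w by move: U1; rewrite E1 !cat_uniq => /and3P [_ _ /and3P []].
have Hi := index_rev Uw aw.
have [a1 a2] : a \notin x :: flatten c1 /\ a \notin y :: flatten (map rev c1).
  split; [move: U1; rewrite E1|move: U2; rewrite E2]; rewrite cat_uniq => /and3P [_ /hasPn H _];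
    by apply: H; rewrite mem_cat ?mem_rev aw.
rewrite P1 P2 E1 E2 !(index_cat a (_ :: _)) (negPf a1) (negPf a2) !index_cat mem_rev aw /= Es1.
rewrite -Hi; move: (index _ w) (index _ (rev w)) (size _) => i j k; clear; lia.
Qed.

Lemma standard_rows q x y t b : row_is q false (x :: t ++ [:: y]) ->
  row_is q true (y :: b ++ [:: x]) -> standard q.
Proof.
have E z w : uniq (rcons w z) -> index z (rcons w z) = size w.
  by rewrite rcons_uniq -cats1 index_cat /= eqxx addn0 => /andP [/negPf->].
move=> H1 H2; have S1 := row_is_size H1; have S2 := row_is_size H2.
case: H1 H2 => U1 _ P1 [U2 _ P2]; split.
  exists x; split; first by rewrite P1 /= eqxx.
  by rewrite P2 -S2 -cat_cons cats1 E ?size_rcons // -cats1.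
exists y; split; first by rewrite P2 /= eqxx.
by rewrite P1 -S1 -cat_cons cats1 E ?size_rcons // -cats1.
Qed.

End Pairs.

Theorem theorem4p4 (A : finType) (p : pair_on A) :
  2 <= #|A| -> is_pair p -> irreducible p ->
  exists q : pair_on A, in_rauzy_class p q /\ standard q /\
    exists ks : seq nat, por_blocks q ks /\
      let s := block_sizes ks in
      [|| type1 s, type2 s, type3 s, type4 s | type5 s].
Proof.
move=> HA Hp Hi.
have [t Ht] := row_exists false Hp; have [b Hb] := row_exists true Hp.
have Hw := irreducible_rows Hi Ht Hb.
have St := row_is_size Ht.
case: (Ht) (Hb) => Ut Mt _ [Ub Mb _].
have Pt : perm_eq t b by apply: uniq_perm => // a; rewrite Mt Mb.
case/lastP: t => [|t z] in Ht Hw St Ut Mt Pt *; first by rewrite -St in HA.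
have zb := Mb z; case/splitPr: b / zb => b b' in Hb Hw Ub Mb Pt *.
rewrite -cats1 in Ht Hw St Ut Mt Pt.
have [|x [y [t1 [b1 R1]]]] := standard_rots Ut Pt Hw.
  by move: HA; rewrite -St size_cat addn1.
have [P1 P2] := rots_perm R1.
have P3 : perm_eq t1 b1.
  rewrite -(perm_cat2r [:: x; y]); rewrite perm_sym in P1.
  have := perm_trans P1 (perm_trans Pt P2); clear => H.
  apply: perm_trans (perm_trans _ H) _; apply/permP => a; do ![rewrite count_cat /=]; lia.
have U1 : uniq t1 by move: Ut; rewrite (perm_uniq P1) /= cat_uniq => /and3P [].
have [s [Hs Hs0 [t2 [b2 [Hr /(sim_rots x y) R2]]]]] := sim_typed_all U1 P3.
have [q [Hq Q1 Q2]] := rots_class (rots_trans R1 R2) Ht Hb.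
exists q; split=> //; split; first exact: standard_rows Q1 Q2.
exists (2 :: scanl addn 2 s); split; first exact: por_blocks_realizes Q1 Q2 Hs0 Hr.
by rewrite block_sizes_scanl.
Qed.
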